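(* Every $3$-oriented Spherical Diagram has at least eight swirls and at least $12$ arcs. Moreover, there exists a $3$-oriented Spherical Occlusion Diagram with exactly eight swirls and exactly $12$ arcs.
   Context: A geodesic arc on the unit sphere in $\mathbb R^3$ is the unique shortest curve joining two non-antipodal points. An arc $a$ blocks an arc $b$ (equivalently, $b$ hits $a$) if an endpoint of $b$ lies in the relative interior of $a$. A Spherical Diagram (SD) is a finite non-empty collection $\mathcal D$ of pairwise interior-disjoint geodesic arcs on the unit sphere such that each arc of $\mathcal D$ is blocked by arcs of $\mathcal D$ at each of its endpoints. A Spherical Occlusion Diagram (SOD) is an SD such that all arcs of $\mathcal D$ that hit the same arc of $\mathcal D$ reach it from the same side. A swirl of an SD is a cycle of arcs, each of which hits the next (and the last hits the first), going either all clockwise or all counterclockwise. An SD $\mathcal D$ is $k$-oriented if there exist a set $P$ of $k$ points on the unit sphere (poles), no two antipodal, and a function $f\colon\mathcal D\to P$ such that each arc $a\in\mathcal D$ lies on a great circle through $f(a)$ but contains neither $f(a)$ nor its antipode $-f(a)$. *)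

(* Defs.v *)
From Stdlib Require Import Reals List Lra.
Open Scope R_scope.

Record vec := Vec { vx : R; vy : R; vz : R }.

Definition vopp (u : vec) : vec := Vec (- vx u) (- vy u) (- vz u).
Definition vadd (u v : vec) : vec := Vec (vx u + vx v) (vy u + vy v) (vz u + vz v).
Definition vscale (s : R) (u : vec) : vec := Vec (s * vx u) (s * vy u) (s * vz u).
Definition dot (u v : vec) : R := vx u * vx v + vy u * vy v + vz u * vz v.
Definition cross (u v : vec) : vec :=
  Vec (vy u * vz v - vz u * vy v) (vz u * vx v - vx u * vz v) (vx u * vy v - vy u * vx v).
Definition det (u v w : vec) : R := dot u (cross v w).

Definition on_sphere (x : vec) : Prop := dot x x = 1.

(** A geodesic arc is given by its two endpoints. *)
Record arc := Arc { ap : vec; aq : vec }.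

Definition valid_arc (a : arc) : Prop :=
  on_sphere (ap a) /\ on_sphere (aq a) /\ ap a <> aq a /\ aq a <> vopp (ap a).

(** Points of the (closed) shortest geodesic arc: normalized nonnegative
    combinations of the endpoints. *)
Definition in_arc (x : vec) (a : arc) : Prop :=
  on_sphere x /\ exists s t, 0 <= s /\ 0 <= t /\
    x = vadd (vscale s (ap a)) (vscale t (aq a)).

Definition in_relint (x : vec) (a : arc) : Prop :=
  on_sphere x /\ exists s t, 0 < s /\ 0 < t /\
    x = vadd (vscale s (ap a)) (vscale t (aq a)).

Definition hit_at (b a : arc) (e f : vec) : Prop :=
  ((e = ap b /\ f = aq b) \/ (e = aq b /\ f = ap b)) /\ in_relint e a.

Definition hits (b a : arc) : Prop := exists e f, hit_at b a e f.

Definition SD (D : list arc) : Prop :=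
  D <> nil /\ NoDup D /\
  (forall a, In a D -> valid_arc a) /\
  (forall a b, In a D -> In b D -> a <> b ->
     forall x, ~ (in_relint x a /\ in_relint x b)) /\
  (forall b, In b D -> forall e, (e = ap b \/ e = aq b) ->
     exists a, In a D /\ in_relint e a).

(** The side of (the great circle of) a from which b reaches it is the sign of
    (ap a x aq a) . f, where f is the non-hitting endpoint of b. *)
Definition SOD (D : list arc) : Prop :=
  SD D /\
  forall a b c e f e' f', In a D -> In b D -> In c D ->
    hit_at b a e f -> hit_at c a e' f' ->
    0 < dot (cross (ap a) (aq a)) f * dot (cross (ap a) (aq a)) f'.

Definition dummy_arc : arc := Arc (Vec 0 0 0) (Vec 0 0 0).

(** Turning at the point e: arriving along b (coming from the direction of
    b's other endpoint f), then continuing along a towards its endpoint e2.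
    The turn is counterclockwise (seen from outside the sphere) iff
    det f e e2 > 0 and clockwise iff det f e e2 < 0. *)
Definition turn_sign (sigma : R) (b a c : arc) : Prop :=
  exists e f e2 f2, hit_at b a e f /\ hit_at a c e2 f2 /\ 0 < sigma * det f e e2.

Definition swirl (D : list arc) (s : list arc) : Prop :=
  s <> nil /\ NoDup s /\ (forall a, In a s -> In a D) /\
  exists sigma, (sigma = 1 \/ sigma = -1) /\
    forall i, (i < length s)%nat ->
      turn_sign sigma
        (nth i s dummy_arc)
        (nth ((i + 1) mod length s) s dummy_arc)
        (nth ((i + 2) mod length s) s dummy_arc).

Definition rotl {A} (n : nat) (l : list A) : list A := skipn n l ++ firstn n l.
Definition swirl_equiv (s1 s2 : list arc) : Prop := exists n, s2 = rotl n s1.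

Definition distinct_swirls (D : list arc) (S : list (list arc)) : Prop :=
  NoDup S /\ (forall s, In s S -> swirl D s) /\
  (forall s1 s2, In s1 S -> In s2 S -> swirl_equiv s1 s2 -> s1 = s2).

Definition at_least_swirls (n : nat) (D : list arc) : Prop :=
  exists S, length S = n /\ distinct_swirls D S.

Definition exactly_swirls (n : nat) (D : list arc) : Prop :=
  exists S, length S = n /\ distinct_swirls D S /\
    (forall s, swirl D s -> exists s', In s' S /\ swirl_equiv s' s).

Definition oriented (k : nat) (D : list arc) : Prop :=
  exists P : list vec, length P = k /\ NoDup P /\
    (forall c, In c P -> on_sphere c) /\
    (forall c c', In c P -> In c' P -> c' <> vopp c) /\
    exists f : arc -> vec, forall a, In a D ->
      In (f a) P /\ det (f a) (ap a) (aq a) = 0 /\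
      ~ in_arc (f a) a /\ ~ in_arc (vopp (f a)) a.

(* Main.v *)
Require Import Defs.
From Stdlib Require Import Reals List Lra Lia ClassicalEpsilon Wf_nat.
Open Scope R_scope.

(** The three poles of a 3-oriented diagram cannot lie on a great circle, since
    no part of a diagram that is closed under hitting fits in an open hemisphere.
    So the poles are the axes of a linear frame, in which the arcs are the central
    projections of axis-parallel segments, and it suffices to find a swirl and an
    arc of each direction in each of the eight open octants.

    Fix the positive octant. Arcs followed towards their poles never leave it, and
    monotonicity of the coordinates shows that it meets arcs of all three
    directions; hence 12 arcs, because an arc meets at most two octants.

    Suppose that there is no swirl in the octant. Call an arc a ray if it enters
    the octant from outside, heading to its pole. Walking from a ray and always
    turning left (or always right), one traces a convex inward spiral; without
    swirl it must exit, which can only happen within its first few arcs. This has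
    two consequences. If a ray of axis X hits an arc, then that arc, followed to
    its pole, ends on a ray of axis X again. And the extreme ray of axis X, the
    closest to the Y corner, hits a ray of axis Z. So, starting from there, rays
    of axes X and Z hit each other alternately forever, and the ratio Y/(X+Z) at
    the successive hitting points decreases strictly: impossible for finitely many
    arcs. The octant has some ray, again by the hemisphere argument.

    The optimal example consists of the segments from (-4,±1,±2) to (4,±1,±2) and
    their images under cyclic permutations of the coordinates. *)

(** * Arcs as cones *)

Definition comb (s t : R) (u v : vec) : vec := vadd (vscale s u) (vscale t v).

Lemma vec_ext u v : vx u = vx v -> vy u = vy v -> vz u = vz v -> u = v.
Proof. destruct u, v; simpl; intros; subst; reflexivity. Qed.

Lemma dot_comb n s t u v : dot n (comb s t u v) = s * dot n u + t * dot n v.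
Proof. unfold dot, comb; simpl; ring. Qed.

Lemma det_comb a b s t u v :
  det a b (comb s t u v) = s * det a b u + t * det a b v.
Proof. unfold det, dot, cross, comb; simpl; ring. Qed.

Lemma det_rot a b c : det a b c = det b c a.
Proof. unfold det, dot, cross; simpl; ring. Qed.

Lemma det_swap a b c : det a b c = - det b a c.
Proof. unfold det, dot, cross; simpl; ring. Qed.

Lemma det_dup a b : det a b b = 0.
Proof. unfold det, dot, cross; simpl; ring. Qed.

Lemma det_dup_l a b : det a b a = 0.
Proof. unfold det, dot, cross; simpl; ring. Qed.

Lemma sum_squares_le0 a b c : a * a + b * b + c * c <= 0 -> a = 0 /\ b = 0 /\ c = 0.
Proof.
  intros H. pose proof (Rle_0_sqr a). pose proof (Rle_0_sqr b). pose proof (Rle_0_sqr c).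
  unfold Rsqr in *. repeat split; apply Rsqr_0_uniq; unfold Rsqr; lra.
Qed.

Lemma dot_self_eq0 u : dot u u = 0 -> u = Vec 0 0 0.
Proof.
  unfold dot; destruct u as [a b c]; simpl; intros H.
  destruct (sum_squares_le0 a b c) as (-> & -> & ->); [lra|reflexivity].
Qed.

(** Cramer's rule expresses [det u v w] times [n] through the dot products of [n] with [u], [v],
    [w]; pairing it with [n] gives the identity [E]. *)
Lemma dot_det_vanish n u v w :
  n <> Vec 0 0 0 -> dot n u = 0 -> dot n v = 0 -> dot n w = 0 -> det u v w = 0.
Proof.
  intros Hn Hu Hv Hw. destruct (Req_dec (det u v w) 0) as [|Hd]; auto.
  exfalso; apply Hn, dot_self_eq0.
  assert (E : det u v w * dot n n =
    dot n u * det n v w + dot n v * det u n w + dot n w * det u v n)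
    by (unfold det, dot, cross; simpl; ring).
  rewrite Hu, Hv, Hw in E. nra.
Qed.

Lemma dots_zero n1 n2 n3 u :
  det n1 n2 n3 <> 0 -> dot n1 u = 0 -> dot n2 u = 0 -> dot n3 u = 0 -> u = Vec 0 0 0.
Proof.
  intros Hn H1 H2 H3. destruct (classic (u = Vec 0 0 0)) as [|Hu]; auto.
  exfalso; apply Hn. apply (dot_det_vanish u); auto; unfold dot in *; lra.
Qed.

Definition flip (a : arc) : arc := Arc (aq a) (ap a).

Lemma flip_flip a : flip (flip a) = a.
Proof. destruct a; reflexivity. Qed.

(** Relative interiors as open cones: unlike [in_relint], this is invariant under
    rescaling and linear maps. *)
Definition crel (a : arc) (x : vec) : Prop :=
  exists s t, 0 < s /\ 0 < t /\ x = comb s t (ap a) (aq a).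

Lemma comb_comm s t u v : comb s t u v = comb t s v u.
Proof. apply vec_ext; simpl; ring. Qed.

Lemma crel_flip a x : crel (flip a) x -> crel a x.
Proof.
  intros (s & t & Hs & Ht & E). exists t, s. rewrite comb_comm. auto.
Qed.

Lemma crel_flip_iff a x : crel (flip a) x <-> crel a x.
Proof.
  split; [apply crel_flip | intros H; apply crel_flip; rewrite flip_flip; exact H].
Qed.

Lemma crel_move d y a b :
  crel d y -> 0 < a -> 0 <= b -> crel d (comb a b y (aq d)).
Proof.
  intros (s & t & Hs & Ht & E) Ha Hb.
  exists (a * s), (a * t + b); repeat split; try nra.
  subst y; apply vec_ext; simpl; ring.
Qed.

(** The squared norms of the sum and difference of the endpoints are 2 plus or minus twice their dot
    product, and neither vector vanishes. *)
Lemma valid_dot_lt a : valid_arc a -> -1 < dot (ap a) (aq a) < 1.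
Proof.
  destruct a as [[p1 p2 p3] [q1 q2 q3]].
  unfold valid_arc, on_sphere, dot; simpl. intros (Hp & Hq & Hne & Hna).
  split; apply Rnot_le_lt; intros H.
  - apply Hna. destruct (sum_squares_le0 (p1+q1) (p2+q2) (p3+q3)) as (H1 & H2 & H3); [nra|].
    apply vec_ext; simpl; lra.
  - apply Hne. destruct (sum_squares_le0 (p1-q1) (p2-q2) (p3-q3)) as (H1 & H2 & H3); [nra|].
    apply vec_ext; simpl; lra.
Qed.

Lemma dot_comm u v : dot u v = dot v u.
Proof. unfold dot; ring. Qed.

(** The Gram determinant [1 - c * c] of the endpoints is nonzero, so pairing the relation with both
    endpoints kills the coefficients. *)
Lemma valid_indep a s t :
  valid_arc a -> comb s t (ap a) (aq a) = Vec 0 0 0 -> s = 0 /\ t = 0.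
Proof.
  intros Hv H. pose proof (valid_dot_lt a Hv) as Hc.
  destruct Hv as (Hp & Hq & _). unfold on_sphere in *.
  assert (H1 : dot (ap a) (comb s t (ap a) (aq a)) = 0) by (rewrite H; unfold dot; simpl; ring).
  assert (H2 : dot (aq a) (comb s t (ap a) (aq a)) = 0) by (rewrite H; unfold dot; simpl; ring).
  rewrite dot_comb in H1, H2. rewrite (dot_comm (aq a) (ap a)) in H2.
  rewrite Hp in H1; rewrite Hq in H2. set (c := dot (ap a) (aq a)) in *.
  assert (Ht : t * (1 - c * c) = 0).
  { replace (t * (1 - c * c)) with ((s * c + t * 1) - c * (s * 1 + t * c)) by ring. rewrite H1, H2; ring. }
  assert (Hs : s * (1 - c * c) = 0).
  { replace (s * (1 - c * c)) with ((s * 1 + t * c) - c * (s * c + t * 1)) by ring. rewrite H1, H2; ring. }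
  assert (Hg : 1 - c * c <> 0) by nra.
  apply Rmult_integral in Ht. apply Rmult_integral in Hs. tauto.
Qed.

Lemma valid_indep2 a s t s' t' :
  valid_arc a -> comb s t (ap a) (aq a) = comb s' t' (ap a) (aq a) -> s = s' /\ t = t'.
Proof.
  intros Hv H. destruct (valid_indep a (s - s') (t - t') Hv) as [H1 H2]; [|lra].
  injection H; intros. apply vec_ext; simpl; lra.
Qed.

(** The coefficients solve the Gram system; the remainder [r] is then orthogonal to [p], [q] and
    [cross p q], hence zero. *)
Lemma valid_span a x :
  valid_arc a -> det (ap a) (aq a) x = 0 -> exists s t, x = comb s t (ap a) (aq a).
Proof.
  intros Hv Hd. pose proof (valid_dot_lt a Hv) as Hc.
  destruct Hv as (Hp & Hq & _). unfold on_sphere in *.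
  destruct a as [p q]; simpl in *. set (c := dot p q) in *.
  assert (Hg : 0 < 1 - c * c) by nra.
  exists ((dot p x - c * dot q x) / (1 - c * c)), ((dot q x - c * dot p x) / (1 - c * c)).
  set (s := (dot p x - c * dot q x) / (1 - c * c)).
  set (t := (dot q x - c * dot p x) / (1 - c * c)).
  set (r := comb 1 (-1) x (comb s t p q)).
  assert (Hr : r = Vec 0 0 0).
  { apply (dots_zero p q (cross p q)).
    - replace (det p q (cross p q)) with (dot p p * dot q q - dot p q * dot p q)
        by (unfold det, dot, cross; simpl; ring).
      fold c. rewrite Hp, Hq. lra.
    - unfold r. rewrite !dot_comb, Hp. fold c. unfold s, t. field. lra.
    - unfold r. rewrite !dot_comb, (dot_comm q p), Hq. fold c. unfold s, t. field. lra.
    - unfold r. rewrite !dot_comb.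
      replace (dot (cross p q) x) with (det p q x) by (unfold det, dot, cross; simpl; ring).
      rewrite Hd. unfold dot, cross; simpl; ring. }
  apply vec_ext; [apply (f_equal vx) in Hr | apply (f_equal vy) in Hr | apply (f_equal vz) in Hr];
    unfold r in Hr; simpl in *; lra.
Qed.

Lemma list_argmin {A} (l : list A) (P : A -> Prop) (F : A -> R) :
  (exists a, In a l /\ P a) ->
  exists a, In a l /\ P a /\ forall b, In b l -> P b -> F a <= F b.
Proof.
  induction l as [|x l IH]; intros (a & Ha & HP); [destruct Ha|].
  destruct (classic (exists a, In a l /\ P a)) as [Hex|Hno].
  - destruct (IH Hex) as (m & Hm & HPm & Hmin).
    destruct (classic (P x /\ F x < F m)) as [[HPx Hlt]|Hn].
    + exists x; repeat split; auto with datatypes.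
      intros b [->|Hb] Pb; [lra|]. pose proof (Hmin b Hb Pb); lra.
    + exists m; repeat split; auto with datatypes.
      intros b [->|Hb] Pb; [|auto].
      apply Rnot_lt_le; intros Hlt; apply Hn; auto.
  - assert (a = x) by (destruct Ha; [auto | exfalso; eauto]). subst a.
    exists x; repeat split; auto with datatypes.
    intros b [->|Hb] Pb; [lra|]. exfalso; eauto.
Qed.

(** Both directions of each arc are kept, so that every endpoint in the diagram is the head of some
    directed arc. *)
Definition dir (D : list arc) (d : arc) : Prop := In d D \/ In (flip d) D.

Lemma dir_flip D d : dir D d -> dir D (flip d).
Proof. intros [H|H]; [right; rewrite flip_flip|left]; auto. Qed.

(** * Directed arcs of a diagram: blocking, transversality, minima *)

Section Diagram.
Variable D : list arc.
Hypothesis HD : SD D.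

Lemma dir_valid d : dir D d -> valid_arc d.
Proof.
  destruct HD as (_ & _ & Hv & _). intros [H|H]; [auto|].
  destruct (Hv _ H) as (H1 & H2 & H3 & H4). unfold flip in *; simpl in *.
  split; [|split; [|split]]; auto.
  intros E. apply H4. rewrite E. destruct (ap d); unfold vopp; simpl; f_equal; ring.
Qed.

(** The factor [r] does not depend on the arc [a], so a vector shared by two open cones yields a
    point shared by two relative interiors. *)
Lemma crel_normalize d x : valid_arc d -> crel d x ->
  exists r, 0 < r /\ on_sphere (vscale r x) /\
    forall a, crel a x -> in_relint (vscale r x) a.
Proof.
  intros Hv (s & t & Hs & Ht & E).
  assert (Hpos : 0 < dot x x).
  { assert (0 <= dot x x) by (unfold dot; nra).
    destruct (Req_dec (dot x x) 0) as [E0|]; [|lra].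
    apply dot_self_eq0 in E0. rewrite E in E0. destruct (valid_indep _ _ _ Hv E0); lra. }
  pose proof (sqrt_lt_R0 _ Hpos) as Hq. pose proof (sqrt_sqrt _ (Rlt_le _ _ Hpos)) as Hqq.
  exists (/ sqrt (dot x x)).
  assert (Hr : 0 < / sqrt (dot x x)) by (apply Rinv_0_lt_compat; auto).
  assert (Hon : on_sphere (vscale (/ sqrt (dot x x)) x)).
  { unfold on_sphere.
    replace (dot (vscale (/ sqrt (dot x x)) x) (vscale (/ sqrt (dot x x)) x))
      with (/ sqrt (dot x x) * / sqrt (dot x x) * dot x x) by (unfold dot; simpl; ring).
    transitivity (/ sqrt (dot x x) * / sqrt (dot x x) * (sqrt (dot x x) * sqrt (dot x x)));
      [rewrite Hqq; reflexivity | field; lra]. }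
  repeat split; auto.
  destruct H as (s' & t' & Hs' & Ht' & E').
  exists (/ sqrt (dot x x) * s'), (/ sqrt (dot x x) * t'); repeat split; try nra.
  set (r := / sqrt (dot x x)) in *. clearbody r. rewrite E'. apply vec_ext; simpl; ring.
Qed.

Lemma dir_disjoint d d' x :
  dir D d -> dir D d' -> crel d x -> crel d' x -> d' = d \/ d' = flip d.
Proof.
  intros Hd Hd' Hx Hx'.
  destruct (crel_normalize d x (dir_valid d Hd) Hx) as (r & Hr & _ & Hin).
  destruct HD as (_ & _ & _ & Hdis & _).
  assert (K : forall a b, In a D -> In b D -> crel a x -> crel b x -> a = b).
  { intros a b Ha Hb Hax Hbx. destruct (classic (a = b)) as [|Hne]; auto.
    exfalso; apply (Hdis a b Ha Hb Hne (vscale r x)); auto. }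
  destruct Hd as [Hd|Hd], Hd' as [Hd'|Hd'].
  - left; symmetry; apply K; auto.
  - right. rewrite <- (flip_flip d'). f_equal. apply K; auto; apply crel_flip_iff; auto.
  - right. apply K; auto; apply crel_flip_iff; auto.
  - left. rewrite <- (flip_flip d'), <- (flip_flip d). f_equal.
    apply K; auto; apply crel_flip_iff; auto.
Qed.

Lemma dir_blocked d : dir D d -> exists d', In d' D /\ crel d' (aq d).
Proof.
  destruct HD as (_ & _ & _ & _ & Hb).
  intros [H|H].
  - destruct (Hb d H (aq d)) as (a & Ha & _ & s & t & Hs & Ht & E); auto.
    exists a; split; auto. exists s, t; auto.
  - destruct (Hb _ H (aq d)) as (a & Ha & _ & s & t & Hs & Ht & E); auto.
    exists a; split; auto. exists s, t; auto.
Qed.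

(** A blocking arc on the great circle of [d] would overlap [d] next to its head, hence be [d] up to
    direction; but the head of [d] is not interior to [d]. *)
Lemma dir_transversal d d' :
  dir D d -> dir D d' -> crel d' (aq d) -> det (ap d) (aq d) (ap d') <> 0.
Proof.
  intros Hd Hd' (s & t & Hs & Ht & E) Hdet.
  pose proof (dir_valid d Hd) as Hv. pose proof (dir_valid d' Hd') as Hv'.
  assert (Hdet' : det (ap d) (aq d) (aq d') = 0).
  { pose proof (det_dup (ap d) (aq d)) as H0. rewrite E in H0 at 2.
    rewrite det_comb, Hdet in H0. nra. }
  destruct (valid_span d _ Hv Hdet) as (a & b & E1).
  destruct (valid_span d _ Hv Hdet') as (a' & b' & E2).
  assert (E3 : comb 0 1 (ap d) (aq d) = comb (s * a + t * a') (s * b + t * b') (ap d) (aq d)).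
  { transitivity (aq d); [apply vec_ext; simpl; ring|].
    rewrite E at 1. rewrite E1, E2. apply vec_ext; simpl; ring. }
  apply valid_indep2 in E3; auto. destruct E3 as [E3 E4].
  (* [z] is the head of [d] moved slightly towards the endpoint of [d'] whose coefficient [x] on
     [ap d] is positive, so it is interior to both arcs; [k] is small enough to keep the coefficient
     on [aq d] positive. *)
  assert (Hshare : forall c e x y, 0 < c -> 0 < e -> 0 < x ->
      (x = a /\ y = b /\ c = s /\ e = t \/ x = a' /\ y = b' /\ c = t /\ e = s) -> False).
  { intros c e x y Hc He Hx Hor.
    set (k := 1 / (1 + Rabs y)).
    assert (Hk : 0 < k) by (unfold k; apply Rdiv_lt_0_compat; pose proof (Rabs_pos y); lra).
    assert (Hky : 0 < 1 + k * y).
    { unfold k. pose proof (Rabs_pos y). pose proof (Rle_abs (- y)). rewrite Rabs_Ropp in H0.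
      replace (1 + 1 / (1 + Rabs y) * y) with ((1 + Rabs y + y) / (1 + Rabs y)) by (field; lra).
      apply Rdiv_lt_0_compat; lra. }
    set (z := comb (k * x) (1 + k * y) (ap d) (aq d)).
    assert (Hz : crel d z) by (exists (k * x), (1 + k * y); repeat split; nra).
    assert (Hz' : crel d' z).
    { unfold z. destruct Hor as [(-> & -> & -> & ->)|(-> & -> & -> & ->)].
      - exists (s + k), t; repeat split; try lra.
        replace (k * a) with (s * a + t * a' + k * a) by (rewrite <- E3; ring).
        rewrite E4, E1, E2. apply vec_ext; simpl; ring.
      - exists s, (t + k); repeat split; try lra.
        replace (k * a') with (s * a + t * a' + k * a') by (rewrite <- E3; ring).
        rewrite E4, E1, E2. apply vec_ext; simpl; ring. }
    destruct (dir_disjoint d d' z Hd Hd' Hz Hz') as [->| ->].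
    - assert (K : comb 0 1 (ap d) (aq d) = comb s t (ap d) (aq d)).
      { rewrite <- E. apply vec_ext; simpl; ring. }
      apply valid_indep2 in K; auto; lra.
    - assert (K : comb 0 1 (ap d) (aq d) = comb t s (ap d) (aq d)).
      { transitivity (aq d); [apply vec_ext; simpl; ring|]. rewrite E at 1.
        apply vec_ext; simpl; ring. }
      apply valid_indep2 in K; auto; lra. }
  destruct (Rtotal_order a 0) as [Ha|[Ha|Ha]].
  - apply (Hshare t s a' b'); auto. nra.
  (* Both endpoints of [d'] would be multiples of [aq d]. *)
  - assert (a' = 0) by nra. subst a a'.
    assert (K : comb b' (- b) (ap d') (aq d') = Vec 0 0 0).
    { rewrite E1, E2. apply vec_ext; simpl; ring. }
    destruct (valid_indep _ _ _ Hv' K). nra.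
  - apply (Hshare s t a b); auto.
Qed.

Lemma dir_list : exists l, forall d, dir D d <-> In d l.
Proof.
  exists (D ++ map flip D). intros d'; split; intros H.
  - apply in_or_app. destruct H; auto. right. rewrite <- (flip_flip d'). apply in_map; auto.
  - apply in_app_or in H; destruct H as [H|H]; [left; auto|].
    apply in_map_iff in H. destruct H as (x & <- & Hx). right; rewrite flip_flip; auto.
Qed.

Lemma dir_argmin (P : arc -> Prop) (F : arc -> R) :
  (exists d, dir D d /\ P d) ->
  exists d, dir D d /\ P d /\ forall b, dir D b -> P b -> F d <= F b.
Proof.
  destruct dir_list as (l & Hl). intros (d & Hd & HP).
  destruct (list_argmin l P F) as (a & Ha & HPa & Hm).
  { exists d; split; auto. apply Hl; auto. }
  exists a; split; [apply Hl; auto|split; auto]. intros b Hb; apply Hm, Hl, Hb.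
Qed.

(* At the endpoint [s u + t v] that minimizes [h], strict convexity of the sphere
   gives [s + t > 1], so [u] or [v] would be smaller. *)
Lemma hemisphere (h : vec) (P : arc -> Prop) :
  (exists d, dir D d /\ P d) ->
  (forall d, P d -> P (flip d)) ->
  (forall d, dir D d -> P d -> 0 < dot h (aq d)) ->
  (forall d d', dir D d -> P d -> dir D d' -> crel d' (aq d) -> P d') -> False.
Proof.
  intros (d0 & Hd0 & HP0) Hflip Hpos Hcl.
  destruct (dir_argmin P (fun d => dot h (aq d))) as (d & Hd & HP & Hmin); [eauto|].
  destruct (dir_blocked d Hd) as (a & Ha & Hc).
  assert (Hda : dir D a) by (left; auto).
  assert (HPa : P a) by (apply (Hcl d a); auto).
  pose proof (Hmin a Hda HPa) as M1.
  pose proof (Hmin (flip a) (dir_flip _ _ Hda) (Hflip a HPa)) as M2.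
  pose proof (Hpos d Hd HP) as Hp.
  pose proof (dir_valid a Hda) as Hva. pose proof (valid_dot_lt a Hva) as Hlt.
  destruct Hva as (Hu & Hv & _).
  pose proof (dir_valid d Hd) as (_ & Hon & _).
  destruct Hc as (s & t & Hs & Ht & E). simpl in M2.
  unfold on_sphere in *.
  assert (En : dot (aq d) (aq d) = s * s * dot (ap a) (ap a) + t * t * dot (aq a) (aq a)
      + 2 * s * t * dot (ap a) (aq a)) by (rewrite E; unfold dot; simpl; ring).
  rewrite Hon, Hu, Hv in En.
  assert (Hst : 1 < s + t).
  { assert (0 < s * t * (1 - dot (ap a) (aq a))) by (repeat apply Rmult_lt_0_compat; lra).
    assert (1 < (s + t) * (s + t)) by nra. nra. }
  assert (Eh : dot h (aq d) = s * dot h (ap a) + t * dot h (aq a)) by (rewrite E at 1; apply dot_comb).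
  assert (0 <= s * (dot h (ap a) - dot h (aq d))) by (apply Rmult_le_pos; lra).
  assert (0 <= t * (dot h (aq a) - dot h (aq d))) by (apply Rmult_le_pos; lra).
  assert (0 < (s + t - 1) * dot h (aq d)) by (apply Rmult_lt_0_compat; lra).
  lra.
Qed.

End Diagram.

(** * Left walks in an octant *)

(** From here on, directed arcs are arcs with tail [ap] and head [aq], and [dot n1],
    [dot n2], [dot n3] serve as coordinates. [lft] is positive to the left of [d] in
    these coordinates, which may reverse the orientation. *)
Definition lft (n1 n2 n3 : vec) (d : arc) (x : vec) : R :=
  det n1 n2 n3 * det (ap d) (aq d) x.

(** [d] heads to the pole of the axis of [n1]: its head is a positive combination
    of its tail and that pole. *)
Definition plus (n1 n2 n3 : vec) (d : arc) : Prop :=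
  exists l m, 0 < l /\ 0 < m /\ dot n1 (aq d) = l * dot n1 (ap d) + m /\
    dot n2 (aq d) = l * dot n2 (ap d) /\ dot n3 (aq d) = l * dot n3 (ap d).

Definition oct (n1 n2 n3 x : vec) : Prop := 0 < dot n1 x /\ 0 < dot n2 x /\ 0 < dot n3 x.

Definition ray (n1 n2 n3 : vec) (d : arc) : Prop :=
  plus n1 n2 n3 d /\ oct n1 n2 n3 (aq d) /\ dot n1 (ap d) <= 0.

Definition typed (D : list arc) (n1 n2 n3 : vec) : Prop := forall d, dir D d ->
  (plus n1 n2 n3 d \/ plus n1 n2 n3 (flip d)) \/
  (plus n2 n3 n1 d \/ plus n2 n3 n1 (flip d)) \/
  (plus n3 n1 n2 d \/ plus n3 n1 n2 (flip d)).

Lemma plus_swap n1 n2 n3 d : plus n1 n2 n3 d -> plus n1 n3 n2 d.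
Proof. intros (l & m & H). exists l, m; tauto. Qed.

(** Multiplicativity of the determinant: the right side is the determinant of the coordinates of
    [u], [v], [w] in the frame. *)
Lemma det_mul n1 n2 n3 u v w : det n1 n2 n3 * det u v w =
  dot n1 u * (dot n2 v * dot n3 w - dot n3 v * dot n2 w) +
  dot n2 u * (dot n3 v * dot n1 w - dot n1 v * dot n3 w) +
  dot n3 u * (dot n1 v * dot n2 w - dot n2 v * dot n1 w).
Proof. unfold det, dot, cross; simpl; ring. Qed.

Lemma lft_rot n1 n2 n3 d x : lft n1 n2 n3 d x = lft n2 n3 n1 d x.
Proof. unfold lft. rewrite (det_rot n1). reflexivity. Qed.

Lemma lft_comb n1 n2 n3 d s t u v :
  lft n1 n2 n3 d (comb s t u v) = s * lft n1 n2 n3 d u + t * lft n1 n2 n3 d v.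
Proof. unfold lft. rewrite det_comb. ring. Qed.

Lemma lft_flip n1 n2 n3 d x : lft n1 n2 n3 (flip d) x = - lft n1 n2 n3 d x.
Proof. unfold lft, flip; simpl. rewrite (det_swap (aq d)). ring. Qed.

Lemma lft_ap n1 n2 n3 d : lft n1 n2 n3 d (ap d) = 0.
Proof. unfold lft. rewrite det_dup_l. ring. Qed.

Lemma lft_aq n1 n2 n3 d : lft n1 n2 n3 d (aq d) = 0.
Proof. unfold lft. rewrite det_dup. ring. Qed.

(** The great circle of [d] passes through the pole of the first axis, so [lft] does not involve the
    coordinate [dot n1]. *)
Lemma plus_lft n1 n2 n3 d : plus n1 n2 n3 d -> exists m, 0 < m /\ forall x,
  lft n1 n2 n3 d x = m * (dot n3 (ap d) * dot n2 x - dot n2 (ap d) * dot n3 x).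
Proof.
  intros (l & m & Hl & Hm & E1 & E2 & E3). exists m; split; auto.
  intros x. unfold lft. rewrite det_mul, E1, E2, E3. ring.
Qed.

Lemma plus_lft_flip n1 n2 n3 d : plus n1 n2 n3 (flip d) -> exists m, 0 < m /\ forall x,
  lft n1 n2 n3 d x = m * (dot n2 (aq d) * dot n3 x - dot n3 (aq d) * dot n2 x).
Proof.
  intros H. destruct (plus_lft _ _ _ _ H) as (m & Hm & E). exists m; split; auto.
  intros x. specialize (E x). rewrite lft_flip in E. simpl in E. lra.
Qed.

(** Going from an interior point to the head only adds a positive multiple of the pole, up to the
    scaling [k]. All monotonicity arguments below rest on this. *)
Lemma plus_move n1 n2 n3 d e : plus n1 n2 n3 d -> crel d e -> exists k v, 0 < k /\ 0 < v /\
  k * dot n1 (aq d) = dot n1 e + v /\ k * dot n2 (aq d) = dot n2 e /\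
  k * dot n3 (aq d) = dot n3 e.
Proof.
  intros (l & m & Hl & Hm & E1 & E2 & E3) (s & t & Hs & Ht & ->).
  rewrite !dot_comb. exists (s / l + t), (s * m / l).
  assert (0 < s / l) by (apply Rdiv_lt_0_compat; lra).
  split; [lra|]. split; [apply Rdiv_lt_0_compat; nra|].
  rewrite E1, E2, E3. repeat split; field; lra.
Qed.

Lemma plus_oct n1 n2 n3 d e : plus n1 n2 n3 d -> crel d e -> oct n1 n2 n3 e ->
  oct n1 n2 n3 (aq d) /\ 0 < dot n2 (ap d) /\ 0 < dot n3 (ap d).
Proof.
  intros Hp Hc (O1 & O2 & O3). destruct (plus_move _ _ _ _ _ Hp Hc) as (k & v & Hk & Hv & E1 & E2 & E3).
  destruct Hp as (l & m & Hl & Hm & F1 & F2 & F3).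
  assert (P1 : 0 < dot n1 (aq d)) by nra.
  assert (P2 : 0 < dot n2 (aq d)) by nra.
  assert (P3 : 0 < dot n3 (aq d)) by nra.
  repeat split; auto; nra.
Qed.

Lemma ray_pos n1 n2 n3 d : ray n1 n2 n3 d ->
  0 < dot n2 (ap d) /\ 0 < dot n3 (ap d) /\ 0 < dot n1 (aq d) /\ 0 < dot n2 (aq d) /\ 0 < dot n3 (aq d).
Proof.
  intros ((l & m & Hl & Hm & F1 & F2 & F3) & (O1 & O2 & O3) & _).
  repeat split; auto; nra.
Qed.

Lemma plus_exit n1 n2 n3 d e : plus n1 n2 n3 (flip d) -> crel d e -> oct n1 n2 n3 e ->
  ~ oct n1 n2 n3 (aq d) ->
  ray n1 n2 n3 (flip d) /\ exists a b, 0 <= a /\ 0 <= b /\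
    dot n1 (comb a b e (aq d)) = 0 /\ 0 < dot n2 (comb a b e (aq d)) /\
    0 < dot n3 (comb a b e (aq d)).
Proof.
  intros Hp Hc He Hn. pose proof (proj2 (crel_flip_iff d e) Hc) as Hc'.
  destruct (plus_oct _ _ _ _ _ Hp Hc' He) as (Ho & P2 & P3).
  simpl in P2, P3. destruct He as (O1 & O2 & O3).
  assert (P1 : dot n1 (aq d) <= 0).
  { apply Rnot_lt_le; intros H. apply Hn; repeat split; auto. }
  split; [repeat split; auto; apply Ho|].
  (* These weights cancel the first coordinate and give the point where the arc reaches the wall. *)
  exists (- dot n1 (aq d)), (dot n1 e). rewrite !dot_comb.
  repeat split; try lra; nra.
Qed.

Section Octant.
Variable D : list arc.
Hypothesis HD : SD D.

(** Both great circles pass through the same pole, so [lft] of [d] has a constant sign, or vanishes,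
    along [d']. It vanishes at the hitting point, hence on all of [d'], against transversality. *)
Lemma same_type_no_hit n1 n2 n3 d d' : det n1 n2 n3 <> 0 ->
  dir D d -> dir D d' -> crel d' (aq d) ->
  plus n1 n2 n3 d \/ plus n1 n2 n3 (flip d) ->
  plus n1 n2 n3 d' \/ plus n1 n2 n3 (flip d') -> False.
Proof.
  intros Hn Hd Hd' Hc T T'.
  assert (F : exists u v, forall x, lft n1 n2 n3 d x = u * dot n2 x + v * dot n3 x).
  { destruct T as [T|T].
    - destruct (plus_lft _ _ _ _ T) as (m & _ & E).
      exists (m * dot n3 (ap d)), (- m * dot n2 (ap d)). intros x; rewrite E; ring.
    - destruct (plus_lft_flip _ _ _ _ T) as (m & _ & E).
      exists (- m * dot n3 (aq d)), (m * dot n2 (aq d)). intros x; rewrite E; ring. }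
  assert (F' : exists l, 0 < l /\ dot n2 (aq d') = l * dot n2 (ap d') /\ dot n3 (aq d') = l * dot n3 (ap d')).
  { destruct T' as [(l & m & Hl & Hm & _ & E2 & E3)|(l & m & Hl & Hm & _ & E2 & E3)].
    - exists l; auto.
    - simpl in *. exists (/ l). split; [apply Rinv_0_lt_compat; auto|].
      rewrite E2, E3. split; field; lra. }
  destruct F as (u & v & F). destruct F' as (l & Hl & E2 & E3).
  pose proof (dir_transversal D HD d d' Hd Hd' Hc) as Ht.
  destruct Hc as (s & t & Hs & Ht' & E).
  pose proof (lft_aq n1 n2 n3 d) as H0. rewrite E, lft_comb, !F, E2, E3 in H0.
  assert (H1 : (s + t * l) * lft n1 n2 n3 d (ap d') = 0) by (rewrite F, <- H0; ring).
  assert (0 < s + t * l) by nra.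
  apply Rmult_integral in H1. destruct H1 as [H1|H1]; [lra|].
  unfold lft in H1. apply Rmult_integral in H1. tauto.
Qed.

Variables n1 n2 n3 : vec.
Hypothesis Hn : det n1 n2 n3 <> 0.

Local Notation L := (lft n1 n2 n3).
Local Notation O := (oct n1 n2 n3).
Local Notation closedO x := (0 <= dot n1 x /\ 0 <= dot n2 x /\ 0 <= dot n3 x).

(** The two ends of the blocking arc lie on opposite sides of [d], so only one direction of it is a
    left turn. *)
Lemma lft_unique_dir d d' d'' : dir D d -> dir D d' -> dir D d'' ->
  crel d' (aq d) -> crel d'' (aq d) -> 0 < L d (aq d') -> 0 < L d (aq d'') -> d'' = d'.
Proof.
  intros Hd Hd' Hd'' Hc Hc' L1 L2.
  destruct (dir_disjoint D HD d' d'' _ Hd' Hd'' Hc Hc') as [|E]; auto.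
  subst d''. simpl in L2. destruct Hc as (s & t & Hs & Ht & E).
  pose proof (lft_aq n1 n2 n3 d) as H0. rewrite E, lft_comb in H0. nra.
Qed.

Lemma left_turn d : dir D d ->
  exists d', dir D d' /\ crel d' (aq d) /\ 0 < L d (aq d').
Proof.
  intros Hd. destruct (dir_blocked D HD d Hd) as (a & Ha & Hc).
  assert (Hda : dir D a) by (left; auto).
  assert (Hne : L d (ap a) <> 0).
  { unfold lft. intros H0. apply Rmult_integral in H0.
    destruct H0; [tauto|]. apply (dir_transversal D HD d a); auto. }
  pose proof Hc as (s & t & Hs & Ht & E).
  pose proof (lft_aq n1 n2 n3 d) as H0. rewrite E, lft_comb in H0.
  destruct (Rlt_dec 0 (L d (aq a))) as [Hp|Hp].
  - exists a; auto.
  - exists (flip a). split; [apply dir_flip; auto|]. split; [apply crel_flip_iff; auto|].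
    simpl. nra.
Qed.

Definition left_walk (w : nat -> arc) : Prop :=
  (forall k, dir D (w k)) /\ (forall k, crel (w (S k)) (aq (w k))) /\
  (forall k, 0 < L (w k) (aq (w (S k)))).

Lemma left_walk_exists d : dir D d -> exists w, w 0%nat = d /\ left_walk w.
Proof.
  intros Hd.
  assert (H : forall a, exists b, dir D a -> dir D b /\ crel b (aq a) /\ 0 < L a (aq b)).
  { intros a. destruct (classic (dir D a)) as [Ha|Ha].
    - destruct (left_turn a Ha) as (b & Hb). exists b; auto.
    - exists a; tauto. }
  pose (f := fun a => proj1_sig (constructive_indefinite_description _ (H a))).
  assert (Hf : forall a, dir D a -> dir D (f a) /\ crel (f a) (aq a) /\ 0 < L a (aq (f a))).
  { intros a. unfold f. destruct (constructive_indefinite_description _ (H a)); auto. }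
  pose (w := fun k => Nat.iter k f d).
  assert (Hw : forall k, dir D (w k)).
  { induction k; [exact Hd|]. apply Hf; auto. }
  exists w. split; [reflexivity|]. repeat split; auto; intros k; apply (Hf (w k)); auto.
Qed.

(** * Convex inward walks and their confinement *)

Section Walk.
Variable w : nat -> arc.
Hypothesis Hw : left_walk w.

(** Turning left onto an arc is the same as reaching it from its left: writing the turning point as
    a combination of the ends of the new arc makes the two determinants proportional. *)
Lemma walk_lft_prev_ap k : 0 < L (w (S k)) (ap (w k)).
Proof.
  destruct Hw as (_ & H2 & H3). destruct (H2 k) as (s & t & Hs & Ht & E).
  specialize (H3 k).
  assert (K : s * L (w (S k)) (ap (w k)) = L (w k) (aq (w (S k)))).
  { unfold lft. transitivity (det n1 n2 n3 * det (ap (w (S k))) (aq (w (S k))) (vscale s (ap (w k)))).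
    - unfold det, dot, cross; simpl; ring.
    - rewrite E. unfold det, dot, cross; simpl; ring. }
  nra.
Qed.

Lemma walk_lft_cur k : L (w (S k)) (aq (w k)) = 0.
Proof.
  destruct Hw as (_ & H2 & _). destruct (H2 k) as (s & t & Hs & Ht & E).
  rewrite E, lft_comb, lft_ap, lft_aq. ring.
Qed.

Lemma walk_lft_prev k : 0 < L (w (S (S k))) (aq (w k)).
Proof.
  destruct Hw as (_ & H2 & _). destruct (H2 k) as (s & t & Hs & Ht & E).
  rewrite E, lft_comb, walk_lft_cur. pose proof (walk_lft_prev_ap (S k)). nra.
Qed.

Definition inward (k : nat) : Prop :=
  O (aq (w k)) /\ forall j, (j <= k)%nat -> 0 <= L (w j) (aq (w k)).

(** An immediate reversal is not a left turn. A later one would put the head of the arc two steps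
    back, strictly left of [w k], strictly right of the earlier arc [w j]. *)
Lemma walk_no_reversal k j : (forall i, (i < k)%nat -> inward i) -> (j < k)%nat ->
  w k <> flip (w j).
Proof.
  intros Hin Hj E. destruct k as [|k]; [lia|].
  destruct (Nat.eq_dec j k) as [->|Hne].
  - destruct Hw as (_ & _ & H3). specialize (H3 k). rewrite E in H3. simpl in H3.
    rewrite lft_ap in H3. lra.
  - destruct k as [|k]; [lia|].
    pose proof (walk_lft_prev k) as H. rewrite E, lft_flip in H.
    destruct (Hin k) as (_ & H'); [lia|]. specialize (H' j ltac:(lia)). lra.
Qed.

(** [A] and [B] hold the values of [n] affine functions at the two ends of a segment; the induction
    replaces the crossing found so far whenever the new function vanishes earlier. *)
Lemma first_crossing (n : nat) (A B : nat -> R) :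
  (forall j, (j < n)%nat -> 0 <= A j) -> (exists j, (j < n)%nat /\ B j < 0) ->
  exists t j, 0 <= t < 1 /\ (j < n)%nat /\ B j < 0 /\ (1 - t) * A j + t * B j = 0 /\
    forall i, (i < n)%nat -> 0 <= (1 - t) * A i + t * B i.
Proof.
  induction n as [|n IH]; intros HA (j & Hj & HB); [lia|].
  assert (Hnew : B n < 0 -> exists t, 0 <= t < 1 /\ (1 - t) * A n + t * B n = 0).
  { intros Hb. specialize (HA n ltac:(lia)). exists (A n / (A n - B n)).
    split; [split|].
    - apply Rmult_le_pos; [lra|]. apply Rlt_le, Rinv_0_lt_compat; lra.
    - apply Rmult_lt_reg_r with (A n - B n); [lra|]. unfold Rdiv.
      rewrite Rmult_assoc, Rinv_l; lra.
    - field; lra. }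
  destruct (classic (exists j, (j < n)%nat /\ B j < 0)) as [Hex|Hno].
  - destruct (IH (fun j H => HA j ltac:(lia)) Hex) as (t & i & Ht & Hi & HBi & E & Hall).
    destruct (Rle_dec 0 ((1 - t) * A n + t * B n)) as [Hok|Hbad].
    + exists t, i. split; [lra|]. split; [lia|]. split; [lra|]. split; [lra|].
      intros i' Hi'. destruct (Nat.eq_dec i' n) as [->|]; auto. apply Hall; lia.
    + assert (HAn := HA n ltac:(lia)).
      assert (HBn : B n < 0) by nra.
      destruct (Hnew HBn) as (t' & Ht' & E').
      assert (Htt : t' < t).
      { apply Rnot_le_lt; intros Hle.
        assert (0 <= (t' - t) * (A n - B n)) by (apply Rmult_le_pos; lra). lra. }
      exists t', n. split; [lra|]. split; [lia|]. split; [lra|]. split; [lra|].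
      intros i' Hi'. destruct (Nat.eq_dec i' n) as [->|Hne]; [lra|].
      specialize (Hall i' ltac:(lia)). specialize (HA i' Hi').
      destruct (Rle_dec 0 (B i')); [nra|]. nra.
  - assert (j = n) by (destruct (Nat.eq_dec j n); auto; exfalso; apply Hno; exists j; split; auto; lia).
    subst j. destruct (Hnew HB) as (t & Ht & E). exists t, n.
    split; [lra|]. split; [lia|]. split; [lra|]. split; [lra|].
    intros i Hi. destruct (Nat.eq_dec i n) as [->|Hne]; [lra|].
    assert (0 <= B i).
    { apply Rnot_lt_le; intros H. apply Hno; exists i; split; auto; lia. }
    specialize (HA i Hi). nra.
Qed.

Hypothesis Hray : ray n1 n2 n3 (w 0%nat).

(* A convex inward spiral cannot leave the region to the left of all its
   previous arcs: at the first crossing, it would cut the part of an earlier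
   arc between two consecutive turns, because the neighbouring half-planes
   exclude the rest of that great circle. For the initial arc, which comes from
   outside the octant, the octant plays the role of the missing neighbour. *)
Lemma walk_confined m a b :
  (forall i, (i <= m)%nat -> inward i) -> 0 <= a -> 0 <= b ->
  closedO (comb a b (aq (w m)) (aq (w (S m)))) ->
  forall j, (j <= m)%nat -> 0 <= L (w j) (comb a b (aq (w m)) (aq (w (S m)))).
Proof.
  intros Hin Ha Hb Hcl j0 Hj0. apply Rnot_lt_le; intros Hneg.
  set (x := comb a b (aq (w m)) (aq (w (S m)))) in *.
  destruct Hw as (Hdir & Hhit & Hleft).
  destruct (first_crossing (S m) (fun j => L (w j) (aq (w m))) (fun j => L (w j) x))
    as (t & j & Ht & Hj & HB & E & Hall).
  { intros j Hj. apply (Hin m); lia. }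
  { exists j0; split; [lia|auto]. }
  cbv beta in *.
  (* [q] is the first point on the way to [x] at which an earlier half-plane is about to be left,
     namely that of [w j]. *)
  set (q := comb (1 - t) t (aq (w m)) x).
  assert (Lq : forall i, (i <= m)%nat -> 0 <= L (w i) q).
  { intros i Hi. unfold q. rewrite lft_comb. apply Hall; lia. }
  assert (Lq0 : L (w j) q = 0) by (unfold q; rewrite lft_comb; auto).
  assert (Oq : O q).
  { destruct (Hin m (le_n m)) as ((O1 & O2 & O3) & _). destruct Hcl as (C1 & C2 & C3).
    unfold q, oct. rewrite !dot_comb. repeat split; nra. }
  assert (Cq : crel (w (S m)) q).
  { replace q with (comb (1 - t + t * a) (t * b) (aq (w m)) (aq (w (S m))))
      by (unfold q, x; apply vec_ext; simpl; ring).
    apply crel_move; auto; nra. }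
  assert (HBe : L (w j) (aq (w (S m))) < 0).
  { unfold x in HB. rewrite lft_comb in HB. destruct (Hin m (le_n m)) as (_ & HA).
    specialize (HA j ltac:(lia)). nra. }
  assert (Hjm : (j < m)%nat).
  { destruct (Nat.eq_dec j m) as [->|]; [|lia]. specialize (Hleft m). lra. }
  assert (Hdetq : det (ap (w j)) (aq (w j)) q = 0).
  { unfold lft in Lq0. apply Rmult_integral in Lq0. tauto. }
  destruct (valid_span (w j) q (dir_valid D HD _ (Hdir j)) Hdetq) as (al & be & Eq).
  (* The half-plane of the next arc excludes the great circle of [w j] beyond its head. *)
  assert (Hal : 0 <= al).
  { specialize (Lq (S j) ltac:(lia)). rewrite Eq, lft_comb, walk_lft_cur in Lq.
    pose proof (walk_lft_prev_ap j). nra. }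
  (* The half-plane of the previous arc, or the octant if [j] is 0, excludes the part before the
     tail. *)
  assert (Hbe : 0 < al -> 0 < be).
  { intros Hal'. destruct j as [|j'].
    - destruct Oq as (O1 & _). rewrite Eq, dot_comb in O1.
      destruct (ray_pos _ _ _ _ Hray) as (_ & _ & P1 & _). destruct Hray as (_ & _ & P2). nra.
    - specialize (Lq j' ltac:(lia)). rewrite Eq, lft_comb in Lq.
      destruct (Hhit j') as (s' & t' & Hs' & Ht' & E').
      pose proof (lft_aq n1 n2 n3 (w j')) as Z0. rewrite E', lft_comb in Z0.
      specialize (Hleft j').
      set (u := L (w j') (ap (w (S j')))) in *. set (v := L (w j') (aq (w (S j')))) in *.
      assert (u < 0) by nra. nra. }
  (* If [al] is 0, then [q] is the turning point at the head of [w j], which is interior to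
     [w (S j)]; otherwise [q] is interior to [w j]. Either way disjointness identifies [w (S m)]
     with an earlier arc. *)
  destruct (Req_dec al 0) as [Eal|Nal].
  - assert (Hbe' : 0 < be).
    { destruct Oq as (O1 & _). rewrite Eq, Eal, dot_comb in O1.
      destruct (Hin j) as ((P1 & _) & _); [lia|]. nra. }
    assert (Cq' : crel (w (S j)) q).
    { destruct (Hhit j) as (s' & t' & Hs' & Ht' & E').
      exists (be * s'), (be * t'). repeat split; try nra.
      rewrite Eq, Eal, E' at 1. apply vec_ext; simpl; ring. }
    destruct (dir_disjoint D HD _ _ q (Hdir (S j)) (Hdir (S m)) Cq' Cq) as [E1|E1].
    + rewrite E1 in HBe. specialize (Hleft j). lra.
    + revert E1. apply walk_no_reversal; [|lia]. intros i Hi; apply Hin; lia.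
  - assert (Cq' : crel (w j) q) by (exists al, be; repeat split; auto; lra || (apply Hbe; lra)).
    destruct (dir_disjoint D HD _ _ q (Hdir j) (Hdir (S m)) Cq' Cq) as [E1|E1];
      rewrite E1 in HBe; simpl in HBe; rewrite ?lft_aq, ?lft_ap in HBe; lra.
Qed.

(** Strong induction on [inward]: with exits excluded, [walk_confined] supplies the half-plane
    conditions. The premise that excludes exits may itself use confinement, which applies to a point
    where the walk would cross a wall. *)
Lemma walk_trapped :
  (forall m, (forall i, (i <= m)%nat -> inward i) ->
    (forall a b, 0 <= a -> 0 <= b -> closedO (comb a b (aq (w m)) (aq (w (S m)))) ->
      forall j, (j <= m)%nat -> 0 <= L (w j) (comb a b (aq (w m)) (aq (w (S m))))) ->
    O (aq (w (S m)))) ->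
  forall k, inward k.
Proof.
  intros Hne k. induction k as [k IH] using lt_wf_ind.
  destruct k as [|m].
  - split; [apply Hray|]. intros j Hj. replace j with 0%nat by lia. rewrite lft_aq; lra.
  - assert (IH' : forall i, (i <= m)%nat -> inward i) by (intros; apply IH; lia).
    assert (HO : O (aq (w (S m)))).
    { apply Hne; auto. intros a b Ha Hb Hc j Hj. apply walk_confined; auto. }
    split; auto. intros j Hj.
    destruct (Nat.eq_dec j (S m)) as [->|]; [rewrite lft_aq; lra|].
    replace (aq (w (S m))) with (comb 0 1 (aq (w m)) (aq (w (S m))))
      by (apply vec_ext; simpl; ring).
    apply walk_confined; auto; try lra; [|lia].
    rewrite !dot_comb. destruct HO as (O1 & O2 & O3). lra.
Qed.

End Walk.
End Octant.

(** * Octants without swirls *)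

Definition touch (n1 n2 n3 : vec) (a : arc) : Prop :=
  oct n1 n2 n3 (ap a) \/ oct n1 n2 n3 (aq a).

(** Swirls are lists of members of [D], whereas walks consist of directed arcs; this forgets the
    direction. *)
Definition und (D : list arc) (d : arc) : arc :=
  if excluded_middle_informative (In d D) then d else flip d.

Lemma und_cases D d : und D d = d \/ und D d = flip d.
Proof. unfold und. destruct excluded_middle_informative; auto. Qed.

Lemma und_in D d : dir D d -> In (und D d) D.
Proof. unfold und. intros [H|H]; destruct excluded_middle_informative; tauto. Qed.

Lemma und_eq D d d' : und D d = und D d' -> d = d' \/ d = flip d'.
Proof.
  intros E. destruct (und_cases D d) as [E1|E1], (und_cases D d') as [E2|E2];
    rewrite E1, E2 in E.
  - auto.
  - auto.
  - right. rewrite <- E. symmetry; apply flip_flip.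
  - left. rewrite <- (flip_flip d), <- (flip_flip d'), E. reflexivity.
Qed.

Section Swirls.
Variable D : list arc.
Hypothesis HD : SD D.

Definition octant_swirl (n1 n2 n3 : vec) : Prop :=
  exists s, swirl D s /\ forall a, In a s -> touch n1 n2 n3 a.

Lemma und_hit d d' : dir D d -> crel d' (aq d) -> hit_at (und D d) (und D d') (aq d) (ap d).
Proof.
  intros Hd Hc. split.
  - destruct (und_cases D d) as [->| ->]; simpl; auto.
  - split; [apply (dir_valid D HD d Hd)|].
    assert (Hc' : crel (und D d') (aq d)).
    { destruct (und_cases D d') as [->| ->]; [auto|apply crel_flip_iff; auto]. }
    exact Hc'.
Qed.

Section Cycle.
Variables n1 n2 n3 : vec.
Hypothesis Hn : det n1 n2 n3 <> 0.
Variable w : nat -> arc.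
Hypothesis Hw : left_walk D n1 n2 n3 w.
Hypothesis Hin : forall k, inward n1 n2 n3 w k.

Lemma walk_und_eq i j : (i < j)%nat -> und D (w i) = und D (w j) -> w i = w j.
Proof.
  intros Hij E. symmetry in E. apply und_eq in E. destruct E as [E|E]; auto.
  exfalso; revert E. apply (walk_no_reversal D n1 n2 n3 w Hw); auto.
Qed.

Lemma walk_repeats : exists i j, (i < j)%nat /\ w i = w j.
Proof.
  apply NNPP; intros Hno.
  set (l := map (fun k => und D (w k)) (seq 0 (S (length D)))).
  assert (Hnd : NoDup l).
  { apply NoDup_map_NoDup_ForallPairs; [|apply seq_NoDup].
    intros i j _ _ E. destruct (Nat.lt_trichotomy i j) as [H|[H|H]]; auto; exfalso; apply Hno.
    - exists i, j; split; auto. apply walk_und_eq; auto.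
    - exists j, i; split; auto. apply walk_und_eq; auto. }
  assert (Hincl : incl l D).
  { intros a Ha. apply in_map_iff in Ha. destruct Ha as (k & <- & _).
    apply und_in, Hw. }
  pose proof (NoDup_incl_length Hnd Hincl) as H. unfold l in H.
  rewrite length_map, length_seq in H. lia.
Qed.

(** Take the first index [j] at which an arc repeats, say that of index [i]. Left turns are
    deterministic, so the walk is periodic from [i] on, and the minimality of [j] makes the arcs of
    one period distinct. *)
Lemma walk_swirl : octant_swirl n1 n2 n3.
Proof.
  destruct Hw as (Hdir & Hhit & Hleft).
  destruct (dec_inh_nat_subset_has_unique_least_element
    (fun j => exists i, (i < j)%nat /\ w i = w j)) as (j & ((i & Hij & E) & Hmin) & _).
  { intros k. apply classic. }
  { destruct walk_repeats as (i & j & H). exists j, i; auto. }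
  set (n := (j - i)%nat).
  assert (Hper : forall k, w (i + k + n)%nat = w (i + k)%nat).
  { induction k as [|k IH].
    - replace (i + 0 + n)%nat with j by (unfold n; lia). rewrite Nat.add_0_r. auto.
    - replace (i + S k + n)%nat with (S (i + k + n)) by lia.
      replace (i + S k)%nat with (S (i + k)) by lia.
      apply (lft_unique_dir D HD n1 n2 n3 (w (i + k)%nat)); auto.
      + rewrite <- IH. apply Hhit.
      + rewrite <- IH at 1. apply Hleft. }
  assert (Hmul : forall q k, w (i + k + q * n)%nat = w (i + k)%nat).
  { induction q as [|q IH]; intros k; [f_equal; lia|].
    replace (i + k + S q * n)%nat with (i + (k + q * n) + n)%nat by lia.
    rewrite Hper, Nat.add_assoc. apply IH. }
  assert (Hn0 : (0 < n)%nat) by (unfold n; lia).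
  assert (Hmod : forall k, w (i + k mod n)%nat = w (i + k)%nat).
  { intros k. rewrite (Nat.div_mod_eq k n) at 2.
    replace (i + (n * (k / n) + k mod n))%nat with (i + k mod n + (k / n) * n)%nat by lia.
    rewrite Hmul; auto. }
  set (s := map (fun k => und D (w (i + k)%nat)) (seq 0 n)).
  assert (Hlen : length s = n) by (unfold s; rewrite length_map, length_seq; auto).
  assert (Hnth : forall k, nth (k mod n) s dummy_arc = und D (w (i + k)%nat)).
  { intros k. rewrite <- Hmod.
    assert (Hk : (k mod n < n)%nat) by (apply Nat.mod_upper_bound; lia).
    unfold s. rewrite (nth_indep _ dummy_arc (und D (w (i + 0)%nat)))
      by (rewrite length_map, length_seq; auto).
    rewrite (map_nth (fun k => und D (w (i + k)%nat)) (seq 0 n) 0%nat).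
    rewrite seq_nth; auto. }
  exists s. split; [split; [|split; [|split]]|].
  - intros E0. rewrite E0 in Hlen. simpl in Hlen. lia.
  - unfold s. apply NoDup_map_NoDup_ForallPairs; [|apply seq_NoDup].
    intros k k' Hk Hk' Ek. apply in_seq in Hk, Hk'.
    destruct (Nat.lt_trichotomy k k') as [H|[H|H]]; auto; exfalso.
    + assert (j <= i + k')%nat; [|unfold n in *; lia].
      apply Hmin. exists (i + k)%nat. split; [lia|]. apply walk_und_eq; auto; lia.
    + assert (j <= i + k)%nat; [|unfold n in *; lia].
      apply Hmin. exists (i + k')%nat. split; [lia|]. apply walk_und_eq; auto; lia.
  - intros a Ha. apply in_map_iff in Ha. destruct Ha as (k & <- & _). apply und_in, Hdir.
  (* [lft] carries the factor [det n1 n2 n3], so left turns are counterclockwise or clockwise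
     according to its sign. *)
  - assert (Hs : exists sigma, (sigma = 1 \/ sigma = -1) /\ 0 < sigma * det n1 n2 n3).
    { destruct (Rlt_dec 0 (det n1 n2 n3)); [exists 1|exists (-1)]; lra. }
    destruct Hs as (sigma & Hs & Hsn). exists sigma; split; auto.
    intros k Hk. rewrite Hlen in *.
    replace (nth k s dummy_arc) with (und D (w (i + k)%nat))
      by (rewrite <- Hnth, Nat.mod_small; auto).
    rewrite !Hnth.
    replace (i + (k + 1))%nat with (S (i + k)) by lia.
    replace (i + (k + 2))%nat with (S (S (i + k))) by lia.
    exists (aq (w (i + k)%nat)), (ap (w (i + k)%nat)), (aq (w (S (i + k)))), (ap (w (S (i + k)))).
    split; [apply und_hit; auto|]. split; [apply und_hit; auto|].
    specialize (Hleft (i + k)%nat). unfold lft in Hleft.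
    set (x := det (ap _) _ _) in *. set (y := det n1 n2 n3) in *.
    destruct Hs; subst sigma; nra.
  - intros a Ha. apply in_map_iff in Ha. destruct Ha as (k & <- & _).
    destruct (Hin (i + k)%nat) as (HO & _).
    destruct (und_cases D (w (i + k)%nat)) as [->| ->]; [right|left]; auto.
Qed.

End Cycle.

Lemma touch_swap n1 n2 n3 a : touch n1 n2 n3 a -> touch n1 n3 n2 a.
Proof. unfold touch, oct. tauto. Qed.
Lemma touch_rot n1 n2 n3 a : touch n1 n2 n3 a -> touch n2 n3 n1 a.
Proof. unfold touch, oct. tauto. Qed.

Lemma octant_swirl_swap n1 n2 n3 : octant_swirl n1 n2 n3 -> octant_swirl n1 n3 n2.
Proof. intros (s & H & Ht). exists s; split; auto using touch_swap. Qed.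
Lemma octant_swirl_rot n1 n2 n3 : octant_swirl n1 n2 n3 -> octant_swirl n2 n3 n1.
Proof. intros (s & H & Ht). exists s; split; auto using touch_rot. Qed.

Lemma typed_rot n1 n2 n3 : typed D n1 n2 n3 -> typed D n2 n3 n1.
Proof. intros H d Hd. specialize (H d Hd). tauto. Qed.
Lemma typed_swap n1 n2 n3 : typed D n1 n2 n3 -> typed D n1 n3 n2.
Proof.
  intros H d Hd. specialize (H d Hd).
  destruct H as [[H|H]|[[H|H]|[H|H]]]; apply plus_swap in H; tauto.
Qed.

Lemma det_swap_r n1 n2 n3 : det n1 n3 n2 = - det n1 n2 n3.
Proof. unfold det, dot, cross; simpl; ring. Qed.

(** * Walks starting from a ray *)

Section Trap.
Variables n1 n2 n3 : vec.
Hypothesis Hn : det n1 n2 n3 <> 0.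
Hypothesis Hty : typed D n1 n2 n3.

Local Notation L := (lft n1 n2 n3).
Local Notation O := (oct n1 n2 n3).
Local Notation PX := (plus n1 n2 n3).
Local Notation PY := (plus n2 n3 n1).
Local Notation PZ := (plus n3 n1 n2).

Lemma plus_lft_Y d : PY d -> exists m, 0 < m /\ forall x,
  L d x = m * (dot n1 (ap d) * dot n3 x - dot n3 (ap d) * dot n1 x).
Proof.
  intros H. destruct (plus_lft _ _ _ _ H) as (m & Hm & E). exists m; split; auto.
  intros x. rewrite lft_rot. apply E.
Qed.

Lemma plus_lft_Z d : PZ d -> exists m, 0 < m /\ forall x,
  L d x = m * (dot n2 (ap d) * dot n1 x - dot n1 (ap d) * dot n2 x).
Proof.
  intros H. destruct (plus_lft _ _ _ _ H) as (m & Hm & E). exists m; split; auto.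
  intros x. rewrite (lft_rot n1 n2 n3), (lft_rot n2 n3 n1). apply E.
Qed.


(** A linear form that vanishes at [e] takes at the head only the contribution of the pole, with
    coefficient [al]. *)
Lemma plus_functional a b c d e (f : vec -> R) al be ga : plus a b c d -> crel d e ->
  (forall x, f x = al * dot a x + be * dot b x + ga * dot c x) -> f e = 0 ->
  exists r, 0 < r /\ f (aq d) = al * r.
Proof.
  intros Hp Hc Hf He. destruct (plus_move _ _ _ _ _ Hp Hc) as (k & v & Hk & Hv & E1 & E2 & E3).
  exists (v / k). split; [apply Rdiv_lt_0_compat; auto|].
  rewrite Hf in *. apply Rmult_eq_reg_l with k; [|lra].
  replace (k * (al * (v / k))) with (al * v) by (field; lra).
  transitivity (al * (k * dot a (aq d)) + be * (k * dot b (aq d)) + ga * (k * dot c (aq d))); [ring|].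
  rewrite E1, E2, E3. lra.
Qed.

(** The sign of [al] tells on which side of [d] the pole lies: a left turn goes towards a pole on
    the left or, in [turn_minus], away from a pole on the right. *)
Lemma turn_plus a b c d d' al be ga : plus a b c d' -> crel d' (aq d) ->
  (forall x, L d x = al * dot a x + be * dot b x + ga * dot c x) -> 0 < L d (aq d') -> 0 < al.
Proof.
  intros Hp Hc Hf Hl.
  destruct (plus_functional _ _ _ _ _ _ _ _ _ Hp Hc Hf (lft_aq _ _ _ _)) as (r & Hr & E). nra.
Qed.

Lemma turn_minus a b c d d' al be ga : plus a b c (flip d') -> crel d' (aq d) ->
  (forall x, L d x = al * dot a x + be * dot b x + ga * dot c x) -> 0 < L d (aq d') -> al < 0.
Proof.
  intros Hp Hc Hf Hl. pose proof (proj2 (crel_flip_iff _ _) Hc) as Hc'.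
  destruct (plus_functional _ _ _ _ _ _ _ _ _ Hp Hc' Hf (lft_aq _ _ _ _)) as (r & Hr & E).
  simpl in E. destruct Hc as (s & t & Hs & Ht & Ee).
  pose proof (lft_aq n1 n2 n3 d) as H0. rewrite Ee, lft_comb, E in H0.
  assert (0 < s * r) by nra. assert (0 < t * L d (aq d')) by nra. nra.
Qed.

(** For an arc meeting the octant, its heading alone fixes the signs of the coefficients of [L d].
    These sign patterns decide which left turns are possible and which walls lie to the right. *)
Lemma classify d e : dir D d -> crel d e -> O e -> exists u v, 0 < u /\ 0 < v /\ (
  (PX d /\ O (aq d) /\ forall x, L d x = 0 * dot n1 x + u * dot n2 x + - v * dot n3 x) \/
  (PX (flip d) /\ forall x, L d x = 0 * dot n1 x + - u * dot n2 x + v * dot n3 x) \/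
  (PY d /\ O (aq d) /\ forall x, L d x = - v * dot n1 x + 0 * dot n2 x + u * dot n3 x) \/
  (PY (flip d) /\ forall x, L d x = v * dot n1 x + 0 * dot n2 x + - u * dot n3 x) \/
  (PZ d /\ O (aq d) /\ forall x, L d x = u * dot n1 x + - v * dot n2 x + 0 * dot n3 x) \/
  (PZ (flip d) /\ forall x, L d x = - u * dot n1 x + v * dot n2 x + 0 * dot n3 x)).
Proof.
  intros Hd Hc HO. pose proof (proj2 (crel_flip_iff _ _) Hc) as Hc'.
  assert (HO2 : oct n2 n3 n1 e) by (unfold oct in *; tauto).
  assert (HO3 : oct n3 n1 n2 e) by (unfold oct in *; tauto).
  destruct (Hty d Hd) as [[H|H]|[[H|H]|[H|H]]].
  - destruct (plus_oct _ _ _ _ _ H Hc HO) as (Oh & P2 & P3).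
    destruct (plus_lft _ _ _ _ H) as (m & Hm & E).
    exists (m * dot n3 (ap d)), (m * dot n2 (ap d)). repeat split; try nra.
    left; repeat split; auto; try apply Oh. intros x; rewrite E; ring.
  - destruct (plus_oct _ _ _ _ _ H Hc' HO) as (Oh & P2 & P3).
    destruct (plus_lft _ _ _ _ H) as (m & Hm & E). simpl in *.
    exists (m * dot n3 (aq d)), (m * dot n2 (aq d)). repeat split; try nra.
    right; left; split; auto. intros x. specialize (E x). rewrite lft_flip in E. lra.
  - destruct (plus_oct _ _ _ _ _ H Hc HO2) as (Oh & P2 & P3).
    destruct (plus_lft_Y _ H) as (m & Hm & E).
    exists (m * dot n1 (ap d)), (m * dot n3 (ap d)). repeat split; try nra.
    right; right; left; repeat split; auto; try apply Oh. intros x; rewrite E; ring.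
  - destruct (plus_oct _ _ _ _ _ H Hc' HO2) as (Oh & P2 & P3).
    destruct (plus_lft_Y _ H) as (m & Hm & E). simpl in *.
    exists (m * dot n1 (aq d)), (m * dot n3 (aq d)). repeat split; try nra.
    right; right; right; left; split; auto. intros x. specialize (E x). rewrite lft_flip in E. lra.
  - destruct (plus_oct _ _ _ _ _ H Hc HO3) as (Oh & P2 & P3).
    destruct (plus_lft_Z _ H) as (m & Hm & E).
    exists (m * dot n2 (ap d)), (m * dot n1 (ap d)). repeat split; try nra.
    do 4 right; left; repeat split; auto; try apply Oh. intros x; rewrite E; ring.
  - destruct (plus_oct _ _ _ _ _ H Hc' HO3) as (Oh & P2 & P3).
    destruct (plus_lft_Z _ H) as (m & Hm & E). simpl in *.
    exists (m * dot n2 (aq d)), (m * dot n1 (aq d)). repeat split; try nra.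
    do 5 right; split; auto. intros x. specialize (E x). rewrite lft_flip in E. lra.
Qed.

Lemma ray_lft d : ray n1 n2 n3 d -> exists u v, 0 < u /\ 0 < v /\
  forall x, L d x = 0 * dot n1 x + u * dot n2 x + - v * dot n3 x.
Proof.
  intros Hr. destruct (ray_pos _ _ _ _ Hr) as (P2 & P3 & _). destruct Hr as (Hp & _).
  destruct (plus_lft _ _ _ _ Hp) as (m & Hm & E).
  exists (m * dot n3 (ap d)), (m * dot n2 (ap d)). repeat split; try nra.
  intros x; rewrite E; ring.
Qed.

(* [z] is the boundary point through which the walk leaves the octant. *)
Lemma walk_exit w m : left_walk D n1 n2 n3 w -> O (aq (w m)) -> ~ O (aq (w (S m))) ->
  (forall a b, 0 <= a -> 0 <= b ->
     (0 <= dot n1 (comb a b (aq (w m)) (aq (w (S m)))) /\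
      0 <= dot n2 (comb a b (aq (w m)) (aq (w (S m)))) /\
      0 <= dot n3 (comb a b (aq (w m)) (aq (w (S m))))) ->
     forall j, (j <= m)%nat -> 0 <= L (w j) (comb a b (aq (w m)) (aq (w (S m))))) ->
  (exists z, ray n1 n2 n3 (flip (w (S m))) /\ dot n1 z = 0 /\ 0 < dot n2 z /\ 0 < dot n3 z /\
     forall j, (j <= m)%nat -> 0 <= L (w j) z) \/
  (exists z, ray n2 n3 n1 (flip (w (S m))) /\ dot n2 z = 0 /\ 0 < dot n3 z /\ 0 < dot n1 z /\
     forall j, (j <= m)%nat -> 0 <= L (w j) z) \/
  (exists z, ray n3 n1 n2 (flip (w (S m))) /\ dot n3 z = 0 /\ 0 < dot n1 z /\ 0 < dot n2 z /\
     forall j, (j <= m)%nat -> 0 <= L (w j) z).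
Proof.
  intros (Hdir & Hhit & Hleft) HO HnO Hconf.
  assert (HO2 : oct n2 n3 n1 (aq (w m))) by (unfold oct in *; tauto).
  assert (HO3 : oct n3 n1 n2 (aq (w m))) by (unfold oct in *; tauto).
  assert (HnO2 : ~ oct n2 n3 n1 (aq (w (S m)))) by (unfold oct in *; tauto).
  assert (HnO3 : ~ oct n3 n1 n2 (aq (w (S m)))) by (unfold oct in *; tauto).
  destruct (classify _ _ (Hdir (S m)) (Hhit m) HO) as
    (u & v & Hu & Hv & [(_ & H & _)|[(H & _)|[(_ & H & _)|[(H & _)|[(_ & H & _)|(H & _)]]]]]);
    try contradiction.
  - left. destruct (plus_exit _ _ _ _ _ H (Hhit m) HO HnO) as (Hr & a & b & Ha & Hb & Z1 & Z2 & Z3).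
    eexists; repeat split; try exact Z1; eauto; try apply Hr. apply Hconf; auto; lra.
  - right; left. destruct (plus_exit _ _ _ _ _ H (Hhit m) HO2 HnO2) as (Hr & a & b & Ha & Hb & Z1 & Z2 & Z3).
    eexists; repeat split; try exact Z1; eauto; try apply Hr. apply Hconf; auto; lra.
  - right; right. destruct (plus_exit _ _ _ _ _ H (Hhit m) HO3 HnO3) as (Hr & a & b & Ha & Hb & Z1 & Z2 & Z3).
    eexists; repeat split; try exact Z1; eauto; try apply Hr. apply Hconf; auto; lra.
Qed.

Hypothesis Hno : ~ octant_swirl n1 n2 n3.

(** A walk that never exits yields a swirl. It cannot exit through the wall [n2 = 0], which lies to
    the right of the initial ray. *)
Lemma walk_escapes w : left_walk D n1 n2 n3 w -> ray n1 n2 n3 (w 0%nat) ->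
  exists m, (forall i, (i <= m)%nat -> inward n1 n2 n3 w i) /\
   ((exists z, ray n1 n2 n3 (flip (w (S m))) /\ dot n1 z = 0 /\ 0 < dot n2 z /\ 0 < dot n3 z /\
     forall j, (j <= m)%nat -> 0 <= L (w j) z) \/
    (exists z, ray n3 n1 n2 (flip (w (S m))) /\ dot n3 z = 0 /\ 0 < dot n1 z /\ 0 < dot n2 z /\
     forall j, (j <= m)%nat -> 0 <= L (w j) z)).
Proof.
  intros Hw Hr. apply NNPP; intros Hneg. apply Hno, (walk_swirl n1 n2 n3 Hn w Hw).
  apply (walk_trapped D HD n1 n2 n3 Hn w Hw Hr).
  intros m Hin Hconf. apply NNPP; intros HnO.
  destruct (walk_exit w m Hw (proj1 (Hin m (le_n m))) HnO Hconf) as [H|[H|H]].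
  - apply Hneg; exists m; auto.
  - destruct H as (z & _ & Z1 & Z2 & Z3 & HL). specialize (HL 0%nat (Nat.le_0_l m)).
    destruct (ray_lft _ Hr) as (u & v & Hu & Hv & E). rewrite E, Z1 in HL. nra.
  - apply Hneg; exists m; auto.
Qed.


Lemma plus_head_lft_Y d c : dir D d -> ray n1 n2 n3 d -> crel c (aq d) -> PY c -> 0 < L d (aq c).
Proof.
  intros Hd Hr Hc Hp. destruct (ray_lft _ Hr) as (u & v & Hu & Hv & E).
  destruct (plus_functional n2 n3 n1 c (aq d) (L d) u (- v) 0 Hp Hc) as (r & Hr' & E').
  - intros x; rewrite E; ring.
  - apply lft_aq.
  - rewrite E'. nra.
Qed.

(** The left walk begins with [d] and [c] and must exit through [n1 = 0]. This forces its third arc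
    to head away from the first pole. If that arc did not exit, the fourth would have the same axis,
    turn right, or have the exit point on its right. So the third arc reversed is the desired
    ray. *)
Lemma trap_middle d c : dir D d -> dir D c -> ray n1 n2 n3 d -> crel c (aq d) -> PY c ->
  exists c2, dir D c2 /\ crel c2 (aq c) /\ ray n1 n2 n3 c2.
Proof.
  intros Hd Hdc Hr Hc Hp.
  destruct (left_walk_exists D HD n1 n2 n3 Hn d Hd) as (w & Hw0 & Hw).
  pose proof Hw as (Hdir & Hhit & Hleft). subst d.
  assert (Ec : w 1%nat = c).
  { apply (lft_unique_dir D HD n1 n2 n3 (w 0%nat)); auto. apply plus_head_lft_Y; auto. }
  subst c. apply NNPP; intros Hnc2.
  assert (Hnr : ~ ray n1 n2 n3 (flip (w 2%nat))).
  { intros H; apply Hnc2. exists (flip (w 2%nat)).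
    split; [apply dir_flip; auto|]. split; auto. apply crel_flip_iff; auto. }
  destruct (walk_escapes w Hw Hr) as (m & Hin & Hex).
  assert (HO : forall i, (i <= m)%nat -> O (aq (w i))) by (intros; apply Hin; auto).
  assert (HO0 : O (aq (w 0%nat))) by (apply HO; lia).
  destruct (classify _ _ (Hdir 1%nat) (Hhit 0%nat) HO0) as (u1 & v1 & Hu1 & Hv1 & H1).
  assert (F1 : O (aq (w 1%nat)) /\ exists u v, 0 < u /\ 0 < v /\
     forall x, L (w 1%nat) x = - v * dot n1 x + 0 * dot n2 x + u * dot n3 x).
  { destruct (plus_oct n2 n3 n1 _ _ Hp (Hhit 0%nat)) as (Oh & P2 & P3);
      [unfold oct in *; tauto|].
    split; [unfold oct in *; tauto|].
    destruct (plus_lft_Y _ Hp) as (k & Hk & E).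
    exists (k * dot n1 (ap (w 1%nat))), (k * dot n3 (ap (w 1%nat))).
    repeat split; try nra. intros x; rewrite E; ring. }
  clear u1 v1 Hu1 Hv1 H1. destruct F1 as (HO1 & u1 & v1 & Hu1 & Hv1 & E1).
  destruct m as [|m].
  { destruct Hex as [(z & (_ & _ & Hz) & _)|(z & (_ & _ & Hz) & _)];
      destruct HO1 as (? & ? & ?); simpl in Hz; lra. }
  destruct Hex as [(z & Hrz & Z1 & Z2 & Z3 & HL)|(z & Hrz & Z1 & Z2 & Z3 & HL)].
  (* The wall [n3 = 0] lies to the right of [c]. *)
  2: { specialize (HL 1%nat ltac:(lia)). rewrite E1, Z1 in HL. nra. }
  destruct m as [|m]; [tauto|].
  destruct (classify _ _ (Hdir 2%nat) (Hhit 1%nat) HO1) as (u2 & v2 & Hu2 & Hv2 & H2).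
  destruct H2 as [(H2 & _ & E2)|[(H2 & E2)|[(H2 & _ & E2)|[(H2 & E2)|[(H2 & _ & E2)|(H2 & E2)]]]]].
  - pose proof (turn_plus _ _ _ _ _ (- v1) 0 u1 H2 (Hhit 1%nat) E1 (Hleft 1%nat)). lra.
  - destruct m as [|m].
    { apply (same_type_no_hit D HD n1 n2 n3 (w 2%nat) (w 3%nat) Hn); auto. right; apply Hrz. }
    destruct (classify _ _ (Hdir 3%nat) (Hhit 2%nat) (HO 2%nat ltac:(lia)))
      as (u3 & v3 & Hu3 & Hv3 & H3).
    specialize (HL 3%nat ltac:(lia)).
    destruct H3 as [(H3 & _ & E3)|[(H3 & E3)|[(H3 & _ & E3)|[(H3 & E3)|[(H3 & _ & E3)|(H3 & E3)]]]]].
    + apply (same_type_no_hit D HD n1 n2 n3 (w 2%nat) (w 3%nat) Hn); auto.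
    + apply (same_type_no_hit D HD n1 n2 n3 (w 2%nat) (w 3%nat) Hn); auto.
    + pose proof (turn_plus n2 n3 n1 _ _ (- u2) v2 0 H3 (Hhit 2%nat)
        ltac:(intros; rewrite E2; ring) (Hleft 2%nat)). lra.
    + rewrite E3, Z1 in HL. nra.
    + rewrite E3, Z1 in HL. nra.
    + pose proof (turn_minus n3 n1 n2 _ _ v2 0 (- u2) H3 (Hhit 2%nat)
        ltac:(intros; rewrite E2; ring) (Hleft 2%nat)). lra.
  - apply (same_type_no_hit D HD n2 n3 n1 (w 1%nat) (w 2%nat)); auto.
    rewrite <- det_rot; auto.
  - apply (same_type_no_hit D HD n2 n3 n1 (w 1%nat) (w 2%nat)); auto.
    rewrite <- det_rot; auto.
  - specialize (HL 2%nat ltac:(lia)). rewrite E2, Z1 in HL. nra.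
  - pose proof (turn_minus n3 n1 n2 _ _ u1 (- v1) 0 H2 (Hhit 1%nat)
        ltac:(intros; rewrite E1; ring) (Hleft 1%nat)). lra.
Qed.

(** Left of [d] is the side of the Y corner, where no other ray of the first axis lies. A left turn
    towards the second pole would lead, by [trap_middle], to such a ray, so the turn is away from
    the third pole. The walk then exits at once: an exit along a ray of the first axis would again
    be on the left, and without an immediate exit the third arc would turn wrongly or have the exit
    point on its right. *)
Lemma trap_top d : dir D d -> ray n1 n2 n3 d ->
  (forall d', dir D d' -> ray n1 n2 n3 d' -> d' <> d -> L d (aq d') < 0) ->
  exists c, dir D c /\ crel c (aq d) /\ ray n3 n1 n2 c.
Proof.
  intros Hd Hr Htop.
  destruct (left_walk_exists D HD n1 n2 n3 Hn d Hd) as (w & Hw0 & Hw).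
  pose proof Hw as (Hdir & Hhit & Hleft). subst d.
  apply NNPP; intros Hnc.
  assert (Hnr : ~ ray n3 n1 n2 (flip (w 1%nat))).
  { intros H; apply Hnc. exists (flip (w 1%nat)).
    split; [apply dir_flip; auto|]. split; auto. apply crel_flip_iff; auto. }
  destruct (ray_lft _ Hr) as (u0 & v0 & Hu0 & Hv0 & E0).
  assert (HO0 : O (aq (w 0%nat))) by apply Hr.
  assert (F1 : exists u v, 0 < u /\ 0 < v /\
     forall x, L (w 1%nat) x = - u * dot n1 x + v * dot n2 x + 0 * dot n3 x).
  { destruct (classify _ _ (Hdir 1%nat) (Hhit 0%nat) HO0) as (u & v & Hu & Hv & H).
    destruct H as [(H & _ & E)|[(H & E)|[(H & _ & E)|[(H & E)|[(H & _ & E)|(H & E)]]]]].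
    - exfalso; apply (same_type_no_hit D HD n1 n2 n3 (w 0%nat) (w 1%nat) Hn); auto. left; apply Hr.
    - exfalso; apply (same_type_no_hit D HD n1 n2 n3 (w 0%nat) (w 1%nat) Hn); auto. left; apply Hr.
    - exfalso. destruct (trap_middle (w 0%nat) (w 1%nat)) as (c2 & Hdc & Hcc & Hrc); auto.
      (* The subtracted multiple of [dot n2] makes the form vanish at the head of [w 1]. The form
         does not involve [dot n1], so it also vanishes at the head of [c2], which is therefore left
         of [d]. *)
      destruct (plus_functional n1 n2 n3 c2 (aq (w 1%nat))
        (fun x => L (w 0%nat) x - (L (w 0%nat) (aq (w 1%nat)) / dot n2 (aq (w 1%nat))) * dot n2 x)
        0 (u0 - L (w 0%nat) (aq (w 1%nat)) / dot n2 (aq (w 1%nat))) (- v0)) as (r & Hr' & Er).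
      + apply Hrc.
      + auto.
      + intros x; cbv beta. rewrite (E0 x). ring.
      + cbv beta. field. destruct (plus_oct n2 n3 n1 _ _ H (Hhit 0%nat)) as ((P & _) & _);
          [unfold oct in *; tauto|lra].
      + cbv beta in Er. assert (P2 : 0 < dot n2 (aq (w 1%nat))).
        { destruct (plus_oct n2 n3 n1 _ _ H (Hhit 0%nat)) as ((P & _) & _);
          [unfold oct in *; tauto|auto]. }
        assert (P : 0 < L (w 0%nat) (aq c2)).
        { assert (0 < L (w 0%nat) (aq (w 1%nat)) / dot n2 (aq (w 1%nat)))
            by (apply Rdiv_lt_0_compat; auto).
          destruct (ray_pos _ _ _ _ Hrc) as (_ & _ & _ & P3 & _). nra. }
        destruct (classic (c2 = w 0%nat)) as [->|Hne].
        * rewrite lft_aq in P. lra.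
        * specialize (Htop c2 Hdc Hrc Hne). lra.
    - exfalso. pose proof (turn_minus n2 n3 n1 _ _ u0 (- v0) 0 H (Hhit 0%nat)
        ltac:(intros; rewrite E0; ring) (Hleft 0%nat)). lra.
    - exfalso. pose proof (turn_plus n3 n1 n2 _ _ (- v0) 0 u0 H (Hhit 0%nat)
        ltac:(intros; rewrite E0; ring) (Hleft 0%nat)). lra.
    - exists u, v; auto. }
  destruct F1 as (u1 & v1 & Hu1 & Hv1 & E1).
  destruct (walk_escapes w Hw Hr) as (m & Hin & Hex).
  assert (HO : forall i, (i <= m)%nat -> O (aq (w i))) by (intros; apply Hin; auto).
  destruct Hex as [(z & Hrz & Z1 & Z2 & Z3 & HL)|(z & Hrz & Z1 & Z2 & Z3 & HL)].
  - pose proof (HL 0%nat ltac:(lia)) as HL0.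
    destruct (classic (flip (w (S m)) = w 0%nat)) as [E|Hne].
    + apply (walk_no_reversal D n1 n2 n3 w Hw (S m) 0); [|lia|].
      * intros i Hi; apply Hin; lia.
      * rewrite <- E. symmetry; apply flip_flip.
    (* Moving along the first axis does not change the side of [d]: the walk meets the exit arc left
       of [d] or on its great circle, whereas that arc should lie strictly to the right. *)
    + specialize (Htop _ (dir_flip _ _ (Hdir (S m))) Hrz Hne). simpl in Htop.
      destruct (Hin m (le_n m)) as (_ & HA). specialize (HA 0%nat ltac:(lia)).
      destruct (plus_move n1 n2 n3 (flip (w (S m))) (aq (w m))) as (k & v & Hk & Hv & F1 & F2 & F3).
      { apply Hrz. } { apply crel_flip_iff; auto. }
      simpl in F1, F2, F3. rewrite E0 in HA, Htop.
      assert (k * (u0 * dot n2 (ap (w (S m))) - v0 * dot n3 (ap (w (S m)))) >= 0); [|nra].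
      replace (k * (u0 * dot n2 (ap (w (S m))) - v0 * dot n3 (ap (w (S m)))))
        with (u0 * (k * dot n2 (ap (w (S m)))) - v0 * (k * dot n3 (ap (w (S m))))) by ring.
      rewrite F2, F3. lra.
  - destruct m as [|m]; [tauto|].
    destruct m as [|m].
    { assert (T : PZ (flip (w 2%nat))) by apply Hrz.
      pose proof (turn_minus n3 n1 n2 _ _ 0 (- u1) v1 T (Hhit 1%nat)
        ltac:(intros; rewrite E1; ring) (Hleft 1%nat)). lra. }
    specialize (HL 2%nat ltac:(lia)).
    destruct (classify _ _ (Hdir 2%nat) (Hhit 1%nat) (HO 1%nat ltac:(lia)))
      as (u2 & v2 & Hu2 & Hv2 & H2).
    destruct H2 as [(H2 & _ & E2)|[(H2 & E2)|[(H2 & _ & E2)|[(H2 & E2)|[(H2 & _ & E2)|(H2 & E2)]]]]].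
    + pose proof (turn_plus n1 n2 n3 _ _ (- u1) v1 0 H2 (Hhit 1%nat) E1 (Hleft 1%nat)). lra.
    + rewrite E2, Z1 in HL. nra.
    + rewrite E2, Z1 in HL. nra.
    + pose proof (turn_minus n2 n3 n1 _ _ v1 0 (- u1) H2 (Hhit 1%nat)
        ltac:(intros; rewrite E1; ring) (Hleft 1%nat)). lra.
    + pose proof (turn_plus n3 n1 n2 _ _ 0 (- u1) v1 H2 (Hhit 1%nat)
        ltac:(intros; rewrite E1; ring) (Hleft 1%nat)). lra.
    + pose proof (turn_minus n3 n1 n2 _ _ 0 (- u1) v1 H2 (Hhit 1%nat)
        ltac:(intros; rewrite E1; ring) (Hleft 1%nat)). lra.
Qed.

End Trap.
End Swirls.

(** * Alternating rays and the existence of a swirl *)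

Lemma oct_rot n1 n2 n3 x : oct n1 n2 n3 x -> oct n2 n3 n1 x.
Proof. unfold oct; tauto. Qed.

Lemma ray_swap n1 n2 n3 d : ray n1 n2 n3 d -> ray n1 n3 n2 d.
Proof. intros (H & HO & Hx). split; [apply plus_swap; auto|]. unfold oct in *; tauto. Qed.

(** Two rays on the same great circle both cover the points just inside the wall; [ray_unique]
    compares them there. *)
Lemma ray_points n1 n2 n3 d : ray n1 n2 n3 d -> exists del, 0 < del /\ forall eps, 0 < eps < del ->
  exists q, crel d q /\ dot n1 q = eps /\ dot n2 q = dot n2 (ap d) /\ dot n3 q = dot n3 (ap d).
Proof.
  intros ((l & m & Hl & Hm & E1 & E2 & E3) & (P1 & _ & _) & HA).
  exists (dot n1 (aq d) / l). split; [apply Rdiv_lt_0_compat; auto|].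
  intros eps (He1 & He2).
  assert (He3 : eps * l < dot n1 (aq d)).
  { apply Rmult_lt_reg_r with (/ l); [apply Rinv_0_lt_compat; auto|].
    rewrite Rmult_assoc, Rinv_r; [|lra]. unfold Rdiv in He2. lra. }
  set (A := dot n1 (ap d)) in *. set (B := dot n1 (aq d)) in *.
  assert (Hden : 0 < B - l * A) by nra.
  exists (comb ((B - l * eps) / (B - l * A)) ((eps - A) / (B - l * A)) (ap d) (aq d)).
  split; [|split; [|split]].
  - eexists; eexists; split; [|split; [|reflexivity]]; apply Rdiv_lt_0_compat; nra.
  - rewrite dot_comb. fold A B. field. lra.
  - rewrite dot_comb, E2. field. lra.
  - rewrite dot_comb, E3. field. lra.
Qed.

Lemma ratio_lt k v y s y' s' : 0 < k -> 0 < v -> 0 < y -> 0 < s ->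
  k * y' = y -> k * s' = s + v -> y' / s' < y / s.
Proof.
  intros Hk Hv Hy Hs E1 E2. assert (Hs' : 0 < s') by nra.
  replace (y' / s') with (y / (s + v)) by (rewrite <- E1, <- E2; field; lra).
  unfold Rdiv. apply Rmult_lt_compat_l; auto. apply Rinv_lt_contravar; nra.
Qed.

Definition anyplus (n1 n2 n3 : vec) (d : arc) : Prop :=
  plus n1 n2 n3 d \/ plus n2 n3 n1 d \/ plus n3 n1 n2 d.

(** Real-valued, so that numbers of positive coordinates can be compared by [dir_argmin]. *)
Definition ind (x : R) : R := if Rlt_dec 0 x then 1 else 0.

Lemma ind_move k x v x' : 0 < k -> 0 <= v -> k * x' = x + v -> ind x <= ind x'.
Proof. unfold ind. intros. destruct (Rlt_dec 0 x), (Rlt_dec 0 x'); nra. Qed.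

Lemma anyplus_move n1 n2 n3 d e : anyplus n1 n2 n3 d -> crel d e -> exists k v1 v2 v3,
  0 < k /\ 0 <= v1 /\ 0 <= v2 /\ 0 <= v3 /\ 0 < v1 + v2 + v3 /\
  k * dot n1 (aq d) = dot n1 e + v1 /\ k * dot n2 (aq d) = dot n2 e + v2 /\
  k * dot n3 (aq d) = dot n3 e + v3.
Proof.
  intros [H|[H|H]] Hc; destruct (plus_move _ _ _ _ _ H Hc) as (k & v & Hk & Hv & E1 & E2 & E3).
  - exists k, v, 0, 0. lra.
  - exists k, 0, v, 0. lra.
  - exists k, 0, 0, v. lra.
Qed.

Section Existence.
Variable D : list arc.
Hypothesis HD : SD D.

Section Frame.
Variables n1 n2 n3 : vec.
Hypothesis Hn : det n1 n2 n3 <> 0.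
Hypothesis Hty : typed D n1 n2 n3.

Local Notation L := (lft n1 n2 n3).
Local Notation O := (oct n1 n2 n3).

Lemma vec_inj u v : dot n1 u = dot n1 v -> dot n2 u = dot n2 v -> dot n3 u = dot n3 v -> u = v.
Proof.
  intros H1 H2 H3. assert (E : comb 1 (-1) u v = Vec 0 0 0).
  { apply (dots_zero n1 n2 n3); auto; rewrite dot_comb; lra. }
  injection E; intros. apply vec_ext; lra.
Qed.

(** The tails have proportional second and third coordinates, with ratio [rho], so the rays share a
    direction just inside the wall. Disjointness leaves [d] or its reverse, and the latter has its
    tail in the octant. *)
Lemma ray_unique d d' : dir D d -> dir D d' -> ray n1 n2 n3 d -> ray n1 n2 n3 d' ->
  L d (aq d') = 0 -> d' = d.
Proof.
  intros Hd Hd' Hr Hr' E.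
  destruct (ray_pos _ _ _ _ Hr) as (P2 & P3 & _). destruct (ray_pos _ _ _ _ Hr') as (Q2 & Q3 & Q1 & _).
  destruct (plus_lft _ _ _ _ (proj1 Hr)) as (m & Hm & EL). rewrite EL in E.
  apply Rmult_integral in E. destruct E as [E|E]; [lra|].
  destruct (proj1 Hr') as (l & m' & Hl & Hm' & _ & F2 & F3). rewrite F2, F3 in E.
  set (rho := dot n2 (ap d') / dot n2 (ap d)).
  assert (Hrho : 0 < rho) by (apply Rdiv_lt_0_compat; auto).
  assert (R2 : dot n2 (ap d') = rho * dot n2 (ap d)) by (unfold rho; field; lra).
  assert (R3 : dot n3 (ap d') = rho * dot n3 (ap d)).
  { apply Rmult_eq_reg_l with (l * dot n2 (ap d)); [|nra].
    transitivity (dot n2 (ap d) * (l * dot n3 (ap d'))); [ring|].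
    transitivity (dot n3 (ap d) * (l * dot n2 (ap d'))); [lra|]. rewrite R2. ring. }
  destruct (ray_points _ _ _ _ Hr) as (del & Hdel & Hpts).
  destruct (ray_points _ _ _ _ Hr') as (del' & Hdel' & Hpts').
  set (eps := Rmin del (del' / rho) / 2).
  assert (Hdr : 0 < del' / rho) by (apply Rdiv_lt_0_compat; auto).
  assert (Hmin : 0 < Rmin del (del' / rho)) by (apply Rmin_glb_lt; auto).
  pose proof (Rmin_l del (del' / rho)) as M1. pose proof (Rmin_r del (del' / rho)) as M2.
  destruct (Hpts eps) as (q & Cq & q1 & q2 & q3); [unfold eps; lra|].
  destruct (Hpts' (rho * eps)) as (q' & Cq' & q1' & q2' & q3').
  { assert (eps < del' / rho) by (unfold eps; lra).
    assert (0 < eps) by (unfold eps; lra). split; [nra|].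
    apply Rmult_lt_compat_l with (r := rho) in H; auto.
    replace (rho * (del' / rho)) with del' in H by (field; lra). lra. }
  assert (Eq : q' = comb rho 0 q q).
  { apply vec_inj; rewrite dot_comb.
    - rewrite q1, q1'. ring.
    - rewrite q2, q2', R2. ring.
    - rewrite q3, q3', R3. ring. }
  assert (Cq2 : crel d q').
  { rewrite Eq. destruct Cq as (s & t & Hs & Ht & ->). exists (rho * s), (rho * t).
    repeat split; try nra. apply vec_ext; simpl; ring. }
  destruct (dir_disjoint D HD d d' q' Hd Hd' Cq2 Cq') as [|E']; auto.
  subst d'. destruct Hr' as (_ & _ & X). simpl in X. destruct Hr as (_ & (Y & _) & _). lra.
Qed.

(** Minimize the slope Z/Y, which is constant along a ray of the first axis; [ray_unique] excludes
    ties. *)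
Lemma topmost_ray : (exists d, dir D d /\ ray n1 n2 n3 d) ->
  exists d, dir D d /\ ray n1 n2 n3 d /\
    forall d', dir D d' -> ray n1 n2 n3 d' -> d' <> d -> L d (aq d') < 0.
Proof.
  intros Hex.
  destruct (dir_argmin D (ray n1 n2 n3) (fun d => dot n3 (aq d) / dot n2 (aq d)) Hex)
    as (d & Hd & Hr & Hmin).
  exists d; split; auto; split; auto. intros d' Hd' Hr' Hne.
  assert (L d (aq d') <> 0) by (intros H; apply Hne, ray_unique; auto).
  specialize (Hmin d' Hd' Hr'). cbv beta in Hmin.
  destruct (ray_pos _ _ _ _ Hr) as (P2 & P3 & _ & P5 & P6).
  destruct (ray_pos _ _ _ _ Hr') as (Q2 & Q3 & _ & Q5 & Q6).
  destruct (plus_lft _ _ _ _ (proj1 Hr)) as (m & Hm & EL). rewrite EL in *.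
  destruct (proj1 Hr) as (l & m' & Hl & Hm' & _ & F2 & F3). rewrite F2, F3 in Hmin.
  replace (l * dot n3 (ap d) / (l * dot n2 (ap d))) with (dot n3 (ap d) / dot n2 (ap d)) in Hmin
    by (field; lra).
  apply Rmult_le_compat_r with (r := dot n2 (aq d') * dot n2 (ap d)) in Hmin; [|nra].
  replace (dot n3 (ap d) / dot n2 (ap d) * (dot n2 (aq d') * dot n2 (ap d)))
    with (dot n3 (ap d) * dot n2 (aq d')) in Hmin by (field; lra).
  replace (dot n3 (aq d') / dot n2 (aq d') * (dot n2 (aq d') * dot n2 (ap d)))
    with (dot n2 (ap d) * dot n3 (aq d')) in Hmin by (field; lra).
  set (u := dot n3 (ap d) * dot n2 (aq d')) in *.
  set (v := dot n2 (ap d) * dot n3 (aq d')) in *.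
  assert (u - v <> 0) by (intros Z; apply H; rewrite Z; ring). nra.
Qed.

End Frame.

(** For the third axis, [trap_middle] is applied to the mirror frame with [n2] and [n3] exchanged,
    where left walks become right walks. *)
Lemma ray_next n1 n2 n3 d c : det n1 n2 n3 <> 0 -> typed D n1 n2 n3 -> ~ octant_swirl D n1 n2 n3 ->
  dir D d -> dir D c -> ray n1 n2 n3 d -> crel c (aq d) ->
  plus n2 n3 n1 c \/ plus n3 n1 n2 c ->
  exists c2, dir D c2 /\ crel c2 (aq c) /\ ray n1 n2 n3 c2.
Proof.
  intros Hn Hty Hno Hd Hdc Hr Hc [Hp|Hp].
  - apply (trap_middle D HD n1 n2 n3 Hn Hty Hno d c); auto.
  - destruct (trap_middle D HD n1 n3 n2) with (d := d) (c := c) as (c2 & H1 & H2 & H3); auto.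
    + rewrite det_swap_r. lra.
    + apply typed_swap; auto.
    + intros H; apply Hno, octant_swirl_swap; auto.
    + apply ray_swap; auto.
    + apply plus_swap; auto.
    + exists c2; split; auto; split; auto. apply ray_swap; auto.
Qed.

(** Among the rays of the first axis that hit a ray of the third, take one minimizing Y/(X+Z) at its
    head. Two further hits lead to another such ray with a smaller ratio. *)
Lemma no_ray n1 n2 n3 : det n1 n2 n3 <> 0 -> typed D n1 n2 n3 -> ~ octant_swirl D n1 n2 n3 ->
  forall d, dir D d -> ~ ray n1 n2 n3 d.
Proof.
  intros Hn Hty Hno d0 Hd0 Hr0.
  assert (Hn3 : det n3 n1 n2 <> 0) by (rewrite det_rot; auto).
  assert (Hty3 : typed D n3 n1 n2) by (do 2 apply typed_rot; auto).
  assert (Hno3 : ~ octant_swirl D n3 n1 n2) by (intros H; apply Hno, octant_swirl_rot; auto).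
  destruct (topmost_ray n1 n2 n3 Hn (ex_intro _ d0 (conj Hd0 Hr0))) as (dt & Hdt & Hrt & Htop).
  destruct (trap_top D HD n1 n2 n3 Hn Hty Hno dt Hdt Hrt Htop) as (ct & Hct).
  destruct (dir_argmin D
    (fun d => ray n1 n2 n3 d /\ exists c, dir D c /\ crel c (aq d) /\ ray n3 n1 n2 c)
    (fun d => dot n2 (aq d) / (dot n1 (aq d) + dot n3 (aq d))))
    as (d & Hd & (Hr & c & Hdc & Hc & Hrc) & Hmin).
  { exists dt; split; auto. split; eauto. }
  destruct (ray_next n1 n2 n3 d c Hn Hty Hno Hd Hdc Hr Hc) as (d2 & Hd2 & Hc2 & Hr2).
  { right; apply Hrc. }
  destruct (ray_next n3 n1 n2 c d2 Hn3 Hty3 Hno3 Hdc Hd2 Hrc Hc2) as (c2 & Hdc2 & Hcc2 & Hrc2).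
  { left; apply Hr2. }
  assert (K := Hmin d2 Hd2 (conj Hr2 (ex_intro _ c2 (conj Hdc2 (conj Hcc2 Hrc2))))).
  cbv beta in K. clear Hmin Htop.
  destruct (plus_move _ _ _ _ _ (proj1 Hrc) Hc) as (k & v & Hk & Hv & E3 & E1 & E2).
  destruct (plus_move _ _ _ _ _ (proj1 Hr2) Hc2) as (k' & v' & Hk' & Hv' & F1 & F2 & F3).
  destruct Hr as (_ & (O1 & O2 & O3) & _).
  revert K. apply Rlt_not_le.
  (* The two moves are composed into one: the scalings multiply and the increments of X+Z add up. *)
  apply (ratio_lt (k * k') (v + k * v')); [nra|nra|lra|lra| |].
  - rewrite Rmult_assoc, F2; auto.
  - replace (k * k' * (dot n1 (aq d2) + dot n3 (aq d2)))
      with (k * (k' * dot n1 (aq d2)) + k * (k' * dot n3 (aq d2))) by ring.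
    rewrite F1, F3, Rmult_plus_distr_l, E1, E3. ring.
Qed.

Lemma typed_plus n1 n2 n3 d : typed D n1 n2 n3 -> dir D d ->
  exists d', dir D d' /\ anyplus n1 n2 n3 d' /\ (d' = d \/ d' = flip d).
Proof.
  intros Hty Hd. unfold anyplus.
  destruct (Hty d Hd) as [[H|H]|[[H|H]|[H|H]]];
    (exists d; tauto) || (exists (flip d); split; [apply dir_flip; auto|tauto]).
Qed.

Lemma next_plus n1 n2 n3 d : typed D n1 n2 n3 -> dir D d ->
  exists d', dir D d' /\ anyplus n1 n2 n3 d' /\ crel d' (aq d).
Proof.
  intros Hty Hd. destruct (dir_blocked D HD d Hd) as (a & Ha & Hc).
  destruct (typed_plus n1 n2 n3 a Hty (or_introl Ha)) as (d' & Hd' & Hp & E).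
  exists d'; split; auto; split; auto. destruct E as [->| ->]; auto. apply crel_flip_iff; auto.
Qed.

(** Without rays no arc leaves the octant. The arcs touching it are then closed under hitting and
    have all endpoints in it, so they lie in the open hemisphere around [n1 + n2 + n3]. *)
Lemma ray_exists n1 n2 n3 : det n1 n2 n3 <> 0 -> typed D n1 n2 n3 ->
  (exists d, dir D d /\ oct n1 n2 n3 (aq d)) ->
  exists d, dir D d /\ (ray n1 n2 n3 d \/ ray n2 n3 n1 d \/ ray n3 n1 n2 d).
Proof.
  intros Hn Hty (d0 & Hd0 & HO0). apply NNPP; intros Hno.
  assert (Hexit : forall a b c d, dir D d -> plus a b c (flip d) -> oct a b c (ap d) ->
     ~ oct a b c (aq d) -> ray a b c (flip d)).
  { intros a b c d Hd (l & m & Hl & Hm & E1 & E2 & E3) (O1 & O2 & O3) HnO.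
    split; [exists l, m; auto|]. simpl in *. split; [repeat split; auto|].
    apply Rnot_lt_le. intros H; apply HnO. repeat split; auto; nra. }
  assert (Hstay : forall a b c d, plus a b c d -> oct a b c (ap d) -> oct a b c (aq d)).
  { intros a b c d (l & m & Hl & Hm & E1 & E2 & E3) (O1 & O2 & O3).
    unfold oct; rewrite E1, E2, E3; repeat split; nra. }
  assert (Hkey : forall d, dir D d -> oct n1 n2 n3 (ap d) -> oct n1 n2 n3 (aq d)).
  { intros d Hd HO. apply NNPP; intros HnO.
    assert (HO2 : oct n2 n3 n1 (ap d)) by (unfold oct in *; tauto).
    assert (HO3 : oct n3 n1 n2 (ap d)) by (unfold oct in *; tauto).
    assert (HnO2 : ~ oct n2 n3 n1 (aq d)) by (unfold oct in *; tauto).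
    assert (HnO3 : ~ oct n3 n1 n2 (aq d)) by (unfold oct in *; tauto).
    destruct (Hty d Hd) as [[H|H]|[[H|H]|[H|H]]]; eauto;
      apply Hno; exists (flip d); split; auto using dir_flip. }
  apply (hemisphere D HD (comb 1 1 n1 (comb 1 1 n2 n3)) (touch n1 n2 n3)).
  - exists d0; split; auto. right; auto.
  - intros d [H|H]; [right|left]; auto.
  - intros d Hd Ht. rewrite dot_comm, !dot_comb.
    rewrite (dot_comm _ n1), (dot_comm _ n2), (dot_comm _ n3).
    assert (HO : oct n1 n2 n3 (aq d)) by (destruct Ht; auto).
    destruct HO as (O1 & O2 & O3). lra.
  - intros d d' Hd Ht Hd' Hc.
    assert (HO : oct n1 n2 n3 (aq d)) by (destruct Ht; auto).
    assert (HO2 : oct n2 n3 n1 (aq d)) by (unfold oct in *; tauto).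
    assert (HO3 : oct n3 n1 n2 (aq d)) by (unfold oct in *; tauto).
    pose proof (proj2 (crel_flip_iff _ _) Hc) as Hc'. unfold touch.
    destruct (Hty d' Hd') as [[H|H]|[[H|H]|[H|H]]].
    + right. apply (plus_oct n1 n2 n3 d' (aq d)); auto.
    + left. apply (plus_oct n1 n2 n3 (flip d') (aq d)); auto.
    + right. do 2 apply oct_rot. apply (plus_oct n2 n3 n1 d' (aq d)); auto.
    + left. do 2 apply oct_rot. apply (plus_oct n2 n3 n1 (flip d') (aq d)); auto.
    + right. apply oct_rot. apply (plus_oct n3 n1 n2 d' (aq d)); auto.
    + left. apply oct_rot. apply (plus_oct n3 n1 n2 (flip d') (aq d)); auto.
Qed.

Lemma octant_swirl_exists n1 n2 n3 : det n1 n2 n3 <> 0 -> typed D n1 n2 n3 ->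
  (exists d, dir D d /\ oct n1 n2 n3 (aq d)) -> octant_swirl D n1 n2 n3.
Proof.
  intros Hn Hty Hex. apply NNPP; intros Hno.
  destruct (ray_exists n1 n2 n3 Hn Hty Hex) as (d & Hd & [H|[H|H]]); revert H.
  - apply no_ray; auto.
  - apply no_ray; auto.
    + rewrite <- det_rot; auto.
    + apply typed_rot; auto.
    + intros H; apply Hno. do 2 apply octant_swirl_rot; auto.
  - apply no_ray; auto.
    + rewrite det_rot; auto.
    + do 2 apply typed_rot; auto.
    + intros H; apply Hno. apply octant_swirl_rot; auto.
Qed.

(** * Every octant is reached, by arcs of every axis *)

Definition cnt (n1 n2 n3 x : vec) : R := ind (dot n1 x) + ind (dot n2 x) + ind (dot n3 x).
Definition nonneg (n1 n2 n3 x : vec) : Prop := 0 <= dot n1 x /\ 0 <= dot n2 x /\ 0 <= dot n3 x.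
Definition maxpos (n1 n2 n3 : vec) (d : arc) : Prop :=
  dir D d /\ nonneg n1 n2 n3 (aq d) /\ forall d', dir D d' -> anyplus n1 n2 n3 d' ->
    nonneg n1 n2 n3 (aq d') -> cnt n1 n2 n3 (aq d') <= cnt n1 n2 n3 (aq d).

Lemma maxpos_rot n1 n2 n3 d : maxpos n1 n2 n3 d -> maxpos n2 n3 n1 d.
Proof.
  intros (H1 & H2 & H3). split; auto. split; [unfold nonneg in *; tauto|].
  intros d' Hd' Hp Hnn. specialize (H3 d' Hd'). unfold cnt, anyplus, nonneg in *.
  assert (ind (dot n1 (aq d')) + ind (dot n2 (aq d')) + ind (dot n3 (aq d')) <=
    ind (dot n1 (aq d)) + ind (dot n2 (aq d)) + ind (dot n3 (aq d))); [|lra].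
  apply H3; tauto.
Qed.

Lemma maxpos_next n1 n2 n3 d d' : maxpos n1 n2 n3 d -> dot n3 (aq d) = 0 ->
  dir D d' -> anyplus n1 n2 n3 d' -> crel d' (aq d) ->
  maxpos n1 n2 n3 d' /\ dot n3 (aq d') = 0 /\ dot n3 (ap d') = 0.
Proof.
  intros (Hd & (N1 & N2 & N3) & Hmax) Hz Hd' Hp Hc.
  destruct (anyplus_move _ _ _ _ _ Hp Hc) as (k & v1 & v2 & v3 & Hk & V1 & V2 & V3 & V & E1 & E2 & E3).
  assert (Hnn : nonneg n1 n2 n3 (aq d')) by (repeat split; nra).
  pose proof (Hmax d' Hd' Hp Hnn) as Hle.
  pose proof (ind_move _ _ _ _ Hk V1 E1) as I1. pose proof (ind_move _ _ _ _ Hk V2 E2) as I2.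
  pose proof (ind_move _ _ _ _ Hk V3 E3) as I3. unfold cnt in Hle.
  assert (Hz' : dot n3 (aq d') = 0).
  { destruct Hnn as (_ & _ & [Hpos|]); auto. exfalso.
    rewrite Hz in *. unfold ind at 3 6 in Hle.
    destruct (Rlt_dec 0 (dot n3 (aq d'))), (Rlt_dec 0 0); lra. }
  split; [|split; auto].
  - split; auto; split; auto. intros d'' Hd'' Hp'' Hn''.
    specialize (Hmax d'' Hd'' Hp'' Hn''). unfold cnt in *. lra.
  - destruct Hc as (s & t & Hs & Ht & E). rewrite E, dot_comb, Hz' in Hz. nra.
Qed.

(** A zero coordinate of a head with the most positive coordinates would persist, and two
    consecutive blocking arcs would lie on the same great circle, against transversality. *)
Lemma maxpos_pos n1 n2 n3 d : det n1 n2 n3 <> 0 -> typed D n1 n2 n3 ->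
  maxpos n1 n2 n3 d -> 0 < dot n3 (aq d).
Proof.
  intros Hn Hty Hm. destruct (proj2 (proj2 (proj1 (proj2 Hm)))) as [|Hz]; auto. exfalso.
  symmetry in Hz. pose proof (proj1 Hm) as Hd.
  destruct (next_plus n1 n2 n3 d Hty Hd) as (d1 & Hd1 & Hp1 & Hc1).
  destruct (maxpos_next _ _ _ d d1 Hm Hz Hd1 Hp1 Hc1) as (Hm1 & Z1 & Z1').
  destruct (next_plus n1 n2 n3 d1 Hty Hd1) as (d2 & Hd2 & Hp2 & Hc2).
  destruct (maxpos_next _ _ _ d1 d2 Hm1 Z1 Hd2 Hp2 Hc2) as (Hm2 & Z2 & Z2').
  apply (dir_transversal D HD d1 d2 Hd1 Hd2 Hc2).
  assert (E : det n1 n2 n3 * det (ap d1) (aq d1) (ap d2) = 0)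
    by (rewrite det_mul, Z1, Z1', Z2'; ring).
  apply Rmult_integral in E. tauto.
Qed.

Lemma posneg_move k x v x' : 0 < k -> 0 <= v -> k * x' = x + v ->
  Rmax 0 x <= k * Rmax 0 x' /\ k * Rmax 0 (- x') <= Rmax 0 (- x) /\
  k * Rmax 0 x' - k * Rmax 0 (- x') = Rmax 0 x - Rmax 0 (- x) + v.
Proof.
  intros Hk Hv E.
  unfold Rmax. destruct (Rle_dec 0 x), (Rle_dec 0 (- x)), (Rle_dec 0 x'), (Rle_dec 0 (- x')); nra.
Qed.

(** Following arcs towards their positive poles decreases the ratio of the negative part [Nn] to the
    positive part [Pp], so a minimal head lies in the closed octant. Maximizing the number of
    positive coordinates then reaches the open octant. *)
Lemma octant_nonempty n1 n2 n3 : det n1 n2 n3 <> 0 -> typed D n1 n2 n3 ->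
  exists d, dir D d /\ anyplus n1 n2 n3 d /\ oct n1 n2 n3 (aq d).
Proof.
  intros Hn Hty.
  set (Pp := fun x => Rmax 0 (dot n1 x) + Rmax 0 (dot n2 x) + Rmax 0 (dot n3 x)).
  set (Nn := fun x => Rmax 0 (- dot n1 x) + Rmax 0 (- dot n2 x) + Rmax 0 (- dot n3 x)).
  assert (Hmove : forall d e, anyplus n1 n2 n3 d -> crel d e -> exists k,
    0 < k /\ Pp e <= k * Pp (aq d) /\ k * Nn (aq d) <= Nn e /\
    Pp e - Nn e < k * Pp (aq d) - k * Nn (aq d)).
  { intros d e Hp Hc.
    destruct (anyplus_move _ _ _ _ _ Hp Hc) as (k & v1 & v2 & v3 & Hk & V1 & V2 & V3 & V & E1 & E2 & E3).
    exists k. unfold Pp, Nn.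
    destruct (posneg_move _ _ _ _ Hk V1 E1) as (A1 & A2 & A3).
    destruct (posneg_move _ _ _ _ Hk V2 E2) as (B1 & B2 & B3).
    destruct (posneg_move _ _ _ _ Hk V3 E3) as (C1 & C2 & C3). lra. }
  assert (HP0 : forall x, 0 <= Pp x).
  { intros x. unfold Pp. pose proof (Rmax_l 0 (dot n1 x)).
    pose proof (Rmax_l 0 (dot n2 x)). pose proof (Rmax_l 0 (dot n3 x)). lra. }
  assert (HN0 : forall x, 0 <= Nn x).
  { intros x. unfold Nn. pose proof (Rmax_l 0 (- dot n1 x)).
    pose proof (Rmax_l 0 (- dot n2 x)). pose proof (Rmax_l 0 (- dot n3 x)). lra. }
  assert (Hst : exists d, dir D d /\ anyplus n1 n2 n3 d /\ 0 < Pp (aq d)).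
  { assert (H : exists d, dir D d /\ 0 < Pp (aq d)).
    { apply NNPP; intros Hno.
      (* If no head had a positive coordinate, the diagram would lie in the open hemisphere around
         [-(n1 + n2 + n3)]. *)
      apply (hemisphere D HD (comb (-1) (-1) n1 (comb 1 1 n2 n3)) (fun _ => True)); auto.
      - destruct HD as (Hnil & _). destruct D as [|a l]; [tauto|].
        exists a; split; auto. left; left; auto.
      - intros d Hd _. rewrite dot_comm, !dot_comb.
        rewrite (dot_comm _ n1), (dot_comm _ n2), (dot_comm _ n3).
        assert (Hle : Pp (aq d) <= 0) by (apply Rnot_lt_le; intros H; apply Hno; exists d; auto).
        unfold Pp in Hle.
        pose proof (Rmax_l 0 (dot n1 (aq d))). pose proof (Rmax_l 0 (dot n2 (aq d))).
        pose proof (Rmax_l 0 (dot n3 (aq d))). pose proof (Rmax_r 0 (dot n1 (aq d))).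
        pose proof (Rmax_r 0 (dot n2 (aq d))). pose proof (Rmax_r 0 (dot n3 (aq d))).
        apply Rnot_le_lt; intros Hsum.
        assert (E : aq d = Vec 0 0 0) by (apply (dots_zero n1 n2 n3); auto; lra).
        destruct (dir_valid D HD d Hd) as (_ & Hon & _). rewrite E in Hon.
        unfold on_sphere, dot in Hon; simpl in Hon. lra. }
    destruct H as (d & Hd & Hpos). destruct (next_plus n1 n2 n3 d Hty Hd) as (d' & Hd' & Hp & Hc).
    exists d'; split; auto; split; auto.
    destruct (Hmove _ _ Hp Hc) as (k & Hk & H1 & _). nra. }
  destruct (dir_argmin D (fun d => anyplus n1 n2 n3 d /\ 0 < Pp (aq d))
    (fun d => Nn (aq d) / Pp (aq d)) Hst) as (d & Hd & (Hp & Hpos) & Hmin).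
  assert (HNd : Nn (aq d) = 0).
  { destruct (HN0 (aq d)) as [Hlt|]; auto. exfalso.
    destruct (next_plus n1 n2 n3 d Hty Hd) as (d' & Hd' & Hp' & Hc).
    destruct (Hmove _ _ Hp' Hc) as (k & Hk & H1 & H2 & H3).
    assert (Hpos' : 0 < Pp (aq d')) by nra.
    specialize (Hmin d' Hd' (conj Hp' Hpos')). cbv beta in Hmin.
    apply Rmult_le_compat_r with (r := Pp (aq d) * (k * Pp (aq d'))) in Hmin; [|nra].
    replace (Nn (aq d) / Pp (aq d) * (Pp (aq d) * (k * Pp (aq d'))))
      with (Nn (aq d) * (k * Pp (aq d'))) in Hmin by (field; lra).
    replace (Nn (aq d') / Pp (aq d') * (Pp (aq d) * (k * Pp (aq d'))))
      with (Pp (aq d) * (k * Nn (aq d'))) in Hmin by (field; lra).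
    set (P' := k * Pp (aq d')) in *. set (N' := k * Nn (aq d')) in *.
    set (P := Pp (aq d)) in *. set (N := Nn (aq d)) in *.
    (* By [H3], the positive part increases strictly or the negative part decreases strictly. *)
    assert (0 <= N * (P' - P)) by nra. assert (0 <= P * (N - N')) by nra.
    destruct (Req_dec (P' - P) 0); [|nra]. assert (0 < P * (N - N')) by nra. nra. }
  assert (Hnn : nonneg n1 n2 n3 (aq d)).
  { unfold Nn in HNd.
    pose proof (Rmax_l 0 (- dot n1 (aq d))). pose proof (Rmax_l 0 (- dot n2 (aq d))).
    pose proof (Rmax_l 0 (- dot n3 (aq d))). pose proof (Rmax_r 0 (- dot n1 (aq d))).
    pose proof (Rmax_r 0 (- dot n2 (aq d))). pose proof (Rmax_r 0 (- dot n3 (aq d))).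
    repeat split; lra. }
  destruct (dir_argmin D (fun d => anyplus n1 n2 n3 d /\ nonneg n1 n2 n3 (aq d))
    (fun d => - cnt n1 n2 n3 (aq d))) as (e & He & (Hpe & Hne) & Hmax).
  { exists d; auto. }
  assert (Hm : maxpos n1 n2 n3 e).
  { split; auto; split; auto. intros d' Hd' Hp' Hn'.
    specialize (Hmax d' Hd' (conj Hp' Hn')). lra. }
  exists e; split; auto; split; auto. repeat split.
  - apply (maxpos_pos n2 n3 n1); [rewrite <- det_rot; auto|apply typed_rot; auto|].
    apply maxpos_rot; auto.
  - apply (maxpos_pos n3 n1 n2); [rewrite det_rot; auto|do 2 apply typed_rot; auto|].
    do 2 apply maxpos_rot; auto.
  - apply (maxpos_pos n1 n2 n3); auto.
Qed.

(** If no arc headed to the third pole inside the octant, the ratio Z/(X+Y) at successive heads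
    would decrease forever. *)
Lemma octant_has_type n1 n2 n3 : det n1 n2 n3 <> 0 -> typed D n1 n2 n3 ->
  exists d, dir D d /\ plus n3 n1 n2 d /\ oct n1 n2 n3 (aq d).
Proof.
  intros Hn Hty. apply NNPP; intros Hno.
  destruct (dir_argmin D (fun d => anyplus n1 n2 n3 d /\ oct n1 n2 n3 (aq d))
    (fun d => dot n3 (aq d) / (dot n1 (aq d) + dot n2 (aq d))) (octant_nonempty n1 n2 n3 Hn Hty))
    as (d & Hd & (Hp & HO) & Hmin).
  destruct (next_plus n1 n2 n3 d Hty Hd) as (d' & Hd' & Hp' & Hc).
  assert (HO' : oct n1 n2 n3 (aq d')).
  { destruct (anyplus_move _ _ _ _ _ Hp' Hc) as (k & v1 & v2 & v3 & Hk & V1 & V2 & V3 & V & E1 & E2 & E3).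
    destruct HO as (O1 & O2 & O3). repeat split; nra. }
  specialize (Hmin d' Hd' (conj Hp' HO')). cbv beta in Hmin.
  destruct HO as (O1 & O2 & O3).
  destruct Hp' as [H|[H|H]]; [| |apply Hno; exists d'; auto];
    destruct (plus_move _ _ _ _ _ H Hc) as (k & v & Hk & Hv & E1 & E2 & E3);
    pose proof (ratio_lt k v (dot n3 (aq d)) (dot n1 (aq d) + dot n2 (aq d))
      (dot n3 (aq d')) (dot n1 (aq d') + dot n2 (aq d'))) as K;
    assert (dot n3 (aq d') / (dot n1 (aq d') + dot n2 (aq d')) <
       dot n3 (aq d) / (dot n1 (aq d) + dot n2 (aq d))) by (apply K; lra); lra.
Qed.

End Existence.

(** * Lower bounds *)

Inductive axis := AX | AY | AZ.

Definition sg (b : bool) : R := if b then 1 else -1.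

Lemma sg_neq0 b : sg b <> 0.
Proof. destruct b; simpl; lra. Qed.

Lemma dot_vscale s n x : dot (vscale s n) x = s * dot n x.
Proof. unfold dot; simpl; ring. Qed.

(** Opposite signs of the coefficients express that the arc contains neither [c] nor its
    antipode. *)
Definition pole_of (c : vec) (d : arc) : Prop :=
  exists al be, c = comb al be (ap d) (aq d) /\ al * be < 0.

Lemma pole_of_flip c d : pole_of c d -> pole_of c (flip d).
Proof.
  intros (al & be & E & H). exists be, al. split; [|lra]. rewrite comb_comm. auto.
Qed.

Lemma pole_of_arc c a : valid_arc a -> on_sphere c -> det c (ap a) (aq a) = 0 ->
  ~ in_arc c a -> ~ in_arc (vopp c) a -> pole_of c a.
Proof.
  intros Hv Hon Hd H1 H2. rewrite det_rot in Hd.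
  destruct (valid_span a c Hv Hd) as (al & be & E). exists al, be. split; auto.
  apply Rnot_le_lt; intros Hle.
  destruct (classic (0 <= al /\ 0 <= be)) as [[Ha Hb]|Hn].
  { apply H1. split; auto. exists al, be; auto. }
  destruct (classic (al <= 0 /\ be <= 0)) as [[Ha Hb]|Hn'].
  { apply H2. split; [unfold on_sphere, dot in *; simpl; lra|].
    exists (- al), (- be). repeat split; try lra. rewrite E. apply vec_ext; simpl; ring. }
  destruct (Rlt_dec al 0), (Rlt_dec be 0); nra.
Qed.

(** Solving for the head writes it as a positive multiple of the tail plus a multiple of the pole;
    the sign of [m] selects the direction. *)
Lemma pole_plus n n' n'' c d : dot n c <> 0 -> dot n' c = 0 -> dot n'' c = 0 ->
  pole_of c d -> plus n n' n'' d \/ plus n n' n'' (flip d).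
Proof.
  intros H1 H2 H3 (al & be & -> & Hab). rewrite !dot_comb in *.
  assert (Hbe : be <> 0) by (intros ->; lra).
  assert (Hal : al <> 0) by (intros ->; lra).
  set (l := - al / be). set (m := (al * dot n (ap d) + be * dot n (aq d)) / be).
  assert (Hl : 0 < l).
  { unfold l. replace (- al / be) with (- (al * be) / (be * be)) by (field; auto).
    apply Rdiv_lt_0_compat; [lra|nra]. }
  assert (E1 : dot n (aq d) = l * dot n (ap d) + m) by (unfold l, m; field; auto).
  assert (E2 : dot n' (aq d) = l * dot n' (ap d)).
  { apply Rmult_eq_reg_l with be; auto. unfold l. field_simplify; auto. lra. }
  assert (E3 : dot n'' (aq d) = l * dot n'' (ap d)).
  { apply Rmult_eq_reg_l with be; auto. unfold l. field_simplify; auto. lra. }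
  assert (Hm : m <> 0).
  { unfold m, Rdiv. apply Rmult_integral_contrapositive. split; auto. apply Rinv_neq_0_compat; auto. }
  destruct (Rdichotomy _ _ Hm) as [Hneg|Hpos].
  - right. exists (/ l), (- m / l).
    split; [apply Rinv_0_lt_compat; auto|]. split; [apply Rdiv_lt_0_compat; lra|].
    simpl. rewrite E1, E2, E3. repeat split; field; lra.
  - left. exists l, m; auto.
Qed.

Lemma cross_neq0 u v : on_sphere u -> on_sphere v -> u <> v -> v <> vopp u ->
  cross u v <> Vec 0 0 0.
Proof.
  intros Hu Hv H1 H2 E.
  pose proof (valid_dot_lt (Arc u v) (conj Hu (conj Hv (conj H1 H2)))) as H. simpl in H.
  assert (K : dot (cross u v) (cross u v) = dot u u * dot v v - dot u v * dot u v)
    by (unfold dot, cross; simpl; ring).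
  unfold on_sphere in *. rewrite E, Hu, Hv in K. unfold dot at 1 in K; simpl in K. nra.
Qed.

Lemma rotl_In {A} n (l : list A) x : In x (rotl n l) <-> In x l.
Proof.
  unfold rotl. rewrite in_app_iff. rewrite <- (firstn_skipn n l) at 3.
  rewrite in_app_iff. tauto.
Qed.

Section Lower.
Variable D : list arc.
Hypothesis HD : SD D.

(** * Poles on a great circle *)

Section Coplanar.
Variable n : vec.
Hypothesis Hn : n <> Vec 0 0 0.
Hypothesis Hpole : forall d, dir D d -> exists c, pole_of c d /\ dot n c = 0.

Lemma coplanar_same_sign d : dir D d -> exists l, 0 < l /\ dot n (aq d) = l * dot n (ap d).
Proof.
  intros Hd. destruct (Hpole d Hd) as (c & (al & be & -> & Hab) & H0). rewrite dot_comb in H0.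
  assert (Hbe : be <> 0) by (intros ->; lra).
  exists (- al / be). split.
  - replace (- al / be) with (- (al * be) / (be * be)) by (field; auto).
    apply Rdiv_lt_0_compat; [lra|nra].
  - apply Rmult_eq_reg_l with be; auto. field_simplify; auto. lra.
Qed.

(** No arc crosses the plane of the poles, so the arcs on its positive side are closed under hitting
    and would fit in an open hemisphere. *)
Lemma coplanar_nonpos d : dir D d -> dot n (aq d) <= 0.
Proof.
  intros Hd. apply Rnot_lt_le; intros Hpos.
  apply (hemisphere D HD n (fun d => dir D d /\ 0 < dot n (aq d))).
  - exists d; auto.
  - intros d' (Hd' & Hp'). split; [apply dir_flip; auto|]. simpl.
    destruct (coplanar_same_sign d' Hd') as (l & Hl & E). nra.
  - tauto.
  - intros d1 d2 H1 (_ & Hp) H2 (s & t & Hs & Ht & E). split; auto.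
    destruct (coplanar_same_sign d2 H2) as (l & Hl & E2).
    rewrite E, dot_comb, E2 in Hp. rewrite E2.
    assert (0 < (s + t * l) * dot n (ap d2)) by lra.
    assert (0 < s + t * l) by nra. assert (0 < dot n (ap d2)) by nra. nra.
Qed.

End Coplanar.

(** Applied to [n] and to its opposite, [coplanar_nonpos] puts all arcs on one great circle, against
    transversality. *)
Lemma poles_not_coplanar n : n <> Vec 0 0 0 ->
  ~ (forall d, dir D d -> exists c, pole_of c d /\ dot n c = 0).
Proof.
  intros Hn Hpole.
  assert (Hpole' : forall d, dir D d -> exists c, pole_of c d /\ dot (vscale (-1) n) c = 0).
  { intros d Hd. destruct (Hpole d Hd) as (c & Hc & E). exists c; split; auto.
    rewrite dot_vscale, E; ring. }
  assert (H0 : forall d, dir D d -> dot n (aq d) = 0).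
  { intros d Hd. pose proof (coplanar_nonpos n Hpole d Hd).
    pose proof (coplanar_nonpos _ Hpole' d Hd) as H'. rewrite dot_vscale in H'. lra. }
  destruct HD as (Hnil & _). destruct D as [|a l] eqn:ED; [tauto|]. rewrite <- ED in *.
  assert (Hda : dir D a) by (rewrite ED; left; left; auto).
  destruct (dir_blocked D HD a Hda) as (b & Hb & Hc).
  assert (Hdb : dir D b) by (left; auto).
  apply (dir_transversal D HD a b Hda Hdb Hc).
  apply (dot_det_vanish n); auto.
  - exact (H0 (flip a) (dir_flip _ _ Hda)).
  - exact (H0 (flip b) (dir_flip _ _ Hdb)).
Qed.

Lemma type_preserves_sign n n' n'' m a : plus n n' n'' a \/ plus n n' n'' (flip a) ->
  m = n' \/ m = n'' -> exists l, 0 < l /\ dot m (aq a) = l * dot m (ap a).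
Proof.
  intros [(l & k & Hl & Hk & E1 & E2 & E3)|(l & k & Hl & Hk & E1 & E2 & E3)] Hm.
  - exists l. split; auto. destruct Hm; subst; auto.
  - simpl in *. exists (/ l). split; [apply Rinv_0_lt_compat; auto|].
    destruct Hm; subst m; [rewrite E2|rewrite E3]; field; lra.
Qed.

(* An arc meeting two octants separated by [n1] has its pole on that axis, and
   two such arcs cannot hit each other. *)
Lemma swirl_one_octant n1 n2 n3 m1 m2 m3 s : det n1 n2 n3 <> 0 -> typed D n1 n2 n3 ->
  swirl D s -> (forall a, In a s -> touch n1 n2 n3 a) -> (forall a, In a s -> touch m1 m2 m3 a) ->
  (forall x, 0 < dot m1 x -> dot n1 x < 0) -> False.
Proof.
  intros Hn Hty (Hne & _ & Hin & sigma & _ & Hturn) Ht Ht' Hopp.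
  assert (HX : forall a, In a s -> plus n1 n2 n3 a \/ plus n1 n2 n3 (flip a)).
  { intros a Ha.
    assert (Hs : forall l, 0 < l -> dot n1 (aq a) <> l * dot n1 (ap a)).
    { intros l Hl E. specialize (Ht a Ha). specialize (Ht' a Ha).
      unfold touch, oct in Ht, Ht'.
      assert (K1 : 0 < dot n1 (ap a) \/ 0 < dot n1 (aq a)) by tauto.
      assert (K2 : dot n1 (ap a) < 0 \/ dot n1 (aq a) < 0).
      { destruct Ht' as [(H & _)|(H & _)]; apply Hopp in H; auto. }
      destruct K1, K2; nra. }
    destruct (Hty a (or_introl (Hin a Ha))) as [H|[H|H]]; auto; exfalso.
    - destruct (type_preserves_sign _ _ _ n1 a H) as (l & Hl & E); auto. apply (Hs l Hl E).
    - destruct (type_preserves_sign _ _ _ n1 a H) as (l & Hl & E); auto. apply (Hs l Hl E). }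
  assert (Hlen : (0 < length s)%nat) by (destruct s; simpl; [tauto|lia]).
  destruct (Hturn 0%nat Hlen) as (e & f & e2 & f2 & (Hends & Hrel) & _).
  set (b := nth 0 s dummy_arc) in *. set (a := nth ((0 + 1) mod length s) s dummy_arc) in *.
  assert (Hb : In b s) by (apply nth_In; auto).
  assert (Ha : In a s) by (apply nth_In, Nat.mod_upper_bound; lia).
  assert (Hc : crel a e) by (destruct Hrel as (_ & H); exact H).
  assert (Hda : dir D a) by (left; auto).
  assert (Hdb : dir D b) by (left; auto).
  pose proof (HX b Hb) as Tb. pose proof (HX a Ha) as Ta.
  destruct Hends as [(-> & _)|(-> & _)].
  - apply (same_type_no_hit D HD n1 n2 n3 (flip b) a Hn); auto using dir_flip.
    rewrite flip_flip. tauto.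
  - apply (same_type_no_hit D HD n1 n2 n3 b a Hn); auto.
Qed.

(** * Counting swirls and arcs *)

Section Counting.
Variables n1 n2 n3 : vec.
Hypothesis Hn : det n1 n2 n3 <> 0.
Hypothesis Hty : forall s1 s2 s3, s1 <> 0 -> s2 <> 0 -> s3 <> 0 ->
  typed D (vscale s1 n1) (vscale s2 n2) (vscale s3 n3).

Lemma det_vscale s1 s2 s3 : s1 <> 0 -> s2 <> 0 -> s3 <> 0 ->
  det (vscale s1 n1) (vscale s2 n2) (vscale s3 n3) <> 0.
Proof.
  intros H1 H2 H3.
  replace (det (vscale s1 n1) (vscale s2 n2) (vscale s3 n3)) with (s1 * s2 * s3 * det n1 n2 n3)
    by (unfold det, dot, cross; simpl; ring).
  repeat apply Rmult_integral_contrapositive_currified; auto.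
Qed.

(** One swirl is chosen for each sign pattern of the frame. By [swirl_one_octant] their sets of arcs
    differ, so they are not rotations of one another either. *)
Lemma eight_swirls : at_least_swirls 8 D.
Proof.
  assert (Hex : forall t : bool * bool * bool, exists s, swirl D s /\ forall a, In a s ->
    touch (vscale (sg (fst (fst t))) n1) (vscale (sg (snd (fst t))) n2) (vscale (sg (snd t)) n3) a).
  { intros t. apply octant_swirl_exists; auto using det_vscale, sg_neq0.
    destruct (octant_nonempty D HD (vscale (sg (fst (fst t))) n1) (vscale (sg (snd (fst t))) n2)
      (vscale (sg (snd t)) n3)) as (d & Hd & _ & HO); auto using det_vscale, sg_neq0.
    exists d; auto. }
  pose (F := fun t => proj1_sig (constructive_indefinite_description _ (Hex t))).
  assert (HF : forall t, swirl D (F t) /\ forall a, In a (F t) ->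
    touch (vscale (sg (fst (fst t))) n1) (vscale (sg (snd (fst t))) n2) (vscale (sg (snd t)) n3) a).
  { intros t. unfold F. destruct (constructive_indefinite_description _ (Hex t)); auto. }
  assert (Hinj : forall t t', (forall a, In a (F t) <-> In a (F t')) -> t = t').
  { intros [[x y] z] [[x' y'] z'] Heq.
    destruct (HF (x, y, z)) as (Hs & H1). destruct (HF (x', y', z')) as (_ & H2). simpl in *.
    assert (H3 : forall a, In a (F (x, y, z)) ->
      touch (vscale (sg x') n1) (vscale (sg y') n2) (vscale (sg z') n3) a)
      by (intros a Ha; apply H2, Heq, Ha).
    clear H2.
    assert (Hd := det_vscale (sg x) (sg y) (sg z) (sg_neq0 _) (sg_neq0 _) (sg_neq0 _)).
    assert (Ht := Hty (sg x) (sg y) (sg z) (sg_neq0 _) (sg_neq0 _) (sg_neq0 _)).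
    assert (Hopp : forall b b' n, b <> b' -> forall v, 0 < dot (vscale (sg b') n) v ->
      dot (vscale (sg b) n) v < 0).
    { intros b b' n Hb v. rewrite !dot_vscale. destruct b, b'; simpl; try tauto; lra. }
    f_equal; [f_equal|].
    - destruct (Bool.bool_dec x x') as [|Hne]; auto. exfalso.
      apply (swirl_one_octant _ _ _ _ _ _ _ Hd Ht Hs H1 H3). apply Hopp; auto.
    - destruct (Bool.bool_dec y y') as [|Hne]; auto. exfalso.
      apply (swirl_one_octant (vscale (sg y) n2) (vscale (sg z) n3) (vscale (sg x) n1)
        (vscale (sg y') n2) (vscale (sg z') n3) (vscale (sg x') n1) (F (x, y, z))); auto.
      + rewrite <- det_rot; auto.
      + apply typed_rot; auto.
      + intros; apply touch_rot; auto.
      + intros; apply touch_rot; auto.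
      + apply Hopp; auto.
    - destruct (Bool.bool_dec z z') as [|Hne]; auto. exfalso.
      apply (swirl_one_octant (vscale (sg z) n3) (vscale (sg x) n1) (vscale (sg y) n2)
        (vscale (sg z') n3) (vscale (sg x') n1) (vscale (sg y') n2) (F (x, y, z))); auto.
      + rewrite det_rot; auto.
      + do 2 apply typed_rot; auto.
      + intros; do 2 apply touch_rot; auto.
      + intros; do 2 apply touch_rot; auto.
      + apply Hopp; auto. }
  set (B := (true :: false :: nil)%list).
  exists (map F (list_prod (list_prod B B) B)). split; [reflexivity|]. split; [|split].
  - apply NoDup_map_NoDup_ForallPairs.
    + intros t t' _ _ E. apply Hinj. rewrite E. tauto.
    + repeat constructor; simpl; intuition congruence.
  - intros s Hs. apply in_map_iff in Hs. destruct Hs as (t & <- & _). apply HF.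
  - intros s s' Hs Hs' (k & E). apply in_map_iff in Hs, Hs'.
    destruct Hs as (t & <- & _). destruct Hs' as (t' & <- & _).
    f_equal. apply Hinj. intros a. rewrite E. symmetry. apply rotl_In.
Qed.

(** The two signs are constant along an arc of the axis of [n]. Three axes with four sign pairs give
    twelve disjoint classes. *)
Definition class (n n' n'' : vec) (b b' : bool) (a : arc) : Prop :=
  In a D /\ (plus n n' n'' a \/ plus n n' n'' (flip a)) /\
  0 < sg b * dot n' (aq a) /\ 0 < sg b' * dot n'' (aq a).

Lemma class_exists n n' n'' b b' : det n n' n'' <> 0 ->
  typed D n (vscale (sg b) n') (vscale (sg b') n'') -> exists a, class n n' n'' b b' a.
Proof.
  intros Hdet Hty'.
  destruct (octant_has_type D HD (vscale (sg b) n') (vscale (sg b') n'') n)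
    as (d & Hd & Hp & (O1 & O2 & _)).
  - rewrite <- det_rot.
    replace (det n (vscale (sg b) n') (vscale (sg b') n'')) with (sg b * sg b' * det n n' n'')
      by (unfold det, dot, cross; simpl; ring).
    repeat apply Rmult_integral_contrapositive_currified; auto using sg_neq0.
  - apply typed_rot; auto.
  - rewrite dot_vscale in O1, O2.
    assert (Hp' : plus n n' n'' d).
    { destruct Hp as (l & m & Hl & Hm & E1 & E2 & E3). rewrite !dot_vscale in E2, E3.
      exists l, m. repeat split; auto.
      - apply Rmult_eq_reg_l with (sg b); [lra|apply sg_neq0].
      - apply Rmult_eq_reg_l with (sg b'); [lra|apply sg_neq0]. }
    exists (und D d). split; [apply und_in; auto|].
    destruct (und_cases D d) as [->| ->]; [auto|].
    rewrite flip_flip. split; auto. simpl.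
    destruct Hp' as (l & m & Hl & Hm & _ & E2 & E3). rewrite E2 in O1; rewrite E3 in O2.
    split; nra.
Qed.

(** The nonzero coordinate [n''] forces the same scaling for both axes; then the coordinate [n']
    would be both purely scaled and also shifted. *)
Lemma class_type_unique n n' n'' b b' c c' a :
  class n n' n'' b b' a -> class n' n'' n c c' a -> False.
Proof.
  intros (_ & T1 & P1 & P2) (_ & T2 & P3 & P4).
  destruct (type_preserves_sign _ _ _ n' a T1) as (l & Hl & E1); auto.
  destruct (type_preserves_sign _ _ _ n'' a T1) as (l' & Hl' & E2); auto.
  destruct (type_preserves_sign _ _ _ n'' a T2) as (k & Hk & E3); auto.
  assert (N3 : dot n'' (aq a) <> 0) by (intros Z; rewrite Z in P2; lra).
  assert (N3' : dot n'' (ap a) <> 0) by (intros Z; rewrite Z in E2; lra).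
  destruct T1 as [(x & y & Hx & Hy & _ & F2 & F3)|(x & y & Hx & Hy & _ & F2 & F3)];
  destruct T2 as [(z & t & Hz & Ht & G1 & G2 & G3)|(z & t & Hz & Ht & G1 & G2 & G3)];
    simpl in *.
  - assert (x = z) by (apply Rmult_eq_reg_r with (dot n'' (ap a)); lra). subst. lra.
  - assert (z * x = 1).
    { apply Rmult_eq_reg_r with (dot n'' (ap a)); auto.
      rewrite Rmult_assoc, <- F3, <- G2. ring. }
    rewrite F2, <- Rmult_assoc, H in G1. lra.
  - assert (z * x = 1).
    { apply Rmult_eq_reg_r with (dot n'' (aq a)); auto.
      rewrite Rmult_assoc, <- F3, <- G2. ring. }
    rewrite F2, <- Rmult_assoc, H in G1. lra.
  - assert (x = z) by (apply Rmult_eq_reg_r with (dot n'' (aq a)); lra). subst. lra.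
Qed.

Lemma class_sign_unique n n' n'' b b' c c' a :
  class n n' n'' b b' a -> class n n' n'' c c' a -> b = c /\ b' = c'.
Proof.
  intros (_ & _ & P1 & P2) (_ & _ & P3 & P4).
  destruct b, b', c, c'; simpl in *; auto; lra.
Qed.

Lemma twelve_arcs : (12 <= length D)%nat.
Proof.
  set (Q := fun (t : axis * (bool * bool)) =>
    match fst t with
    | AX => class n1 n2 n3 (fst (snd t)) (snd (snd t))
    | AY => class n2 n3 n1 (fst (snd t)) (snd (snd t))
    | AZ => class n3 n1 n2 (fst (snd t)) (snd (snd t))
    end).
  assert (one : forall n, vscale 1 n = n) by (intros; apply vec_ext; simpl; ring).
  assert (H1 : 1 <> 0) by lra.
  assert (Hex : forall t, exists a, Q t a).
  { intros [[] [b b']]; unfold Q; simpl; apply class_exists.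
    - auto.
    - pose proof (Hty 1 (sg b) (sg b') H1 (sg_neq0 _) (sg_neq0 _)) as H. rewrite one in H. auto.
    - rewrite <- det_rot; auto.
    - pose proof (Hty (sg b') 1 (sg b) (sg_neq0 _) H1 (sg_neq0 _)) as H. rewrite one in H.
      apply typed_rot; auto.
    - rewrite det_rot; auto.
    - pose proof (Hty (sg b) (sg b') 1 (sg_neq0 _) (sg_neq0 _) H1) as H. rewrite one in H.
      do 2 apply typed_rot; auto. }
  pose (F := fun t => proj1_sig (constructive_indefinite_description _ (Hex t))).
  assert (HF : forall t, Q t (F t)).
  { intros t. unfold F. destruct (constructive_indefinite_description _ (Hex t)); auto. }
  set (B := (true :: false :: nil)%list).
  set (l := list_prod (AX :: AY :: AZ :: nil) (list_prod B B)).
  assert (Hnd : NoDup (map F l)).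
  { apply NoDup_map_NoDup_ForallPairs.
    - intros t t' _ _ E. pose proof (HF t) as Ht. pose proof (HF t') as Ht'. rewrite <- E in Ht'.
      destruct t as [i [b b']], t' as [i' [c c']].
      destruct i, i'; unfold Q in Ht, Ht'; simpl in Ht, Ht';
        try (exfalso; exact (class_type_unique _ _ _ _ _ _ _ _ Ht Ht') ||
             exact (class_type_unique _ _ _ _ _ _ _ _ Ht' Ht));
        destruct (class_sign_unique _ _ _ _ _ _ _ _ Ht Ht') as (-> & ->); reflexivity.
    - repeat constructor; simpl; intuition congruence. }
  assert (Hincl : incl (map F l) D).
  { intros a Ha. apply in_map_iff in Ha. destruct Ha as ([i [b b']] & <- & _).
    pose proof (HF (i, (b, b'))) as H. destruct i; apply H. }
  pose proof (NoDup_incl_length Hnd Hincl) as H. rewrite length_map in H. exact H.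
Qed.

End Counting.

Lemma three_oriented_bounds : oriented 3 D -> at_least_swirls 8 D /\ (12 <= length D)%nat.
Proof.
  intros (P & Hlen & Hnd & Hon & Hna & f & Hf).
  destruct P as [|p1 [|p2 [|p3 [|]]]]; try discriminate Hlen. clear Hlen.
  assert (Hpole : forall d, dir D d -> exists c, In c (p1 :: p2 :: p3 :: nil) /\ pole_of c d).
  { intros d Hd.
    assert (K : forall a, In a D -> exists c, In c (p1 :: p2 :: p3 :: nil) /\ pole_of c a).
    { intros a Ha. destruct (Hf a Ha) as (Hin & Hdet & H1 & H2). exists (f a); split; auto.
      apply pole_of_arc; auto. apply (dir_valid D HD a (or_introl Ha)). }
    destruct Hd as [Hd|Hd]; auto. destruct (K _ Hd) as (c & Hc & Hp). exists c; split; auto.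
    rewrite <- (flip_flip d). apply pole_of_flip; auto. }
  assert (Hp12 : cross p1 p2 <> Vec 0 0 0).
  { inversion_clear Hnd. apply cross_neq0; auto with datatypes.
    intros ->; apply H; left; auto. }
  destruct (Req_dec (det p1 p2 p3) 0) as [Hz|Hnz].
  - exfalso. apply (poles_not_coplanar (cross p1 p2) Hp12). intros d Hd.
    destruct (Hpole d Hd) as (c & Hc & Hp). exists c; split; auto.
    destruct Hc as [<-|[<-|[<-|[]]]];
      [unfold dot, cross; simpl; ring..|].
    rewrite <- Hz. unfold det, dot, cross; simpl; ring.
  (* The dual frame: each pole has only its own coordinate nonzero, and that coordinate is
     [det p1 p2 p3]. *)
  - assert (Hn : det (cross p2 p3) (cross p3 p1) (cross p1 p2) <> 0).
    { replace (det (cross p2 p3) (cross p3 p1) (cross p1 p2)) with (det p1 p2 p3 * det p1 p2 p3)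
        by (unfold det, dot, cross; simpl; ring).
      apply Rmult_integral_contrapositive_currified; auto. }
    assert (Hty : forall s1 s2 s3, s1 <> 0 -> s2 <> 0 -> s3 <> 0 ->
      typed D (vscale s1 (cross p2 p3)) (vscale s2 (cross p3 p1)) (vscale s3 (cross p1 p2))).
    { intros s1 s2 s3 H1 H2 H3 d Hd. destruct (Hpole d Hd) as (c & Hc & Hp).
      assert (Z : forall s n, dot n c = 0 -> dot (vscale s n) c = 0)
        by (intros s n E; rewrite dot_vscale, E; ring).
      assert (N : forall s n, s <> 0 -> dot n c = det p1 p2 p3 -> dot (vscale s n) c <> 0)
        by (intros s n Hs E; rewrite dot_vscale, E;
            apply Rmult_integral_contrapositive_currified; auto).
      destruct Hc as [<-|[<-|[<-|[]]]]; [left|right; left|right; right];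
        (apply pole_plus with (4 := Hp);
          [apply N; auto|apply Z|apply Z]; unfold det, dot, cross; simpl; ring). }
    split; [eapply eight_swirls; eauto|eapply twelve_arcs; eauto].
Qed.

End Lower.

(** * The example with twelve arcs *)

(** The code [(i, (s, t))] stands for the arc parallel to axis [i] (in central
    projection) whose next two coordinates in cyclic order are [±1] and [±2],
    with signs [s] and [t], and whose [i]-th coordinate ranges over [[-4, 4]]. *)
Definition code : Type := axis * (bool * bool).

Definition next_axis (i : axis) : axis := match i with AX => AY | AY => AZ | AZ => AX end.

Definition corner (c : code) (h : bool) : vec :=
  let '(i, (s, t)) := c in
  match i with
  | AX => Vec (4 * sg h) (sg s) (2 * sg t)
  | AY => Vec (2 * sg t) (4 * sg h) (sg s)
  | AZ => Vec (sg s) (2 * sg t) (4 * sg h)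
  end.

(** All corners have squared norm 16 + 4 + 1 = 21. *)
Definition unit : R := / sqrt 21.

Lemma unit_pos : 0 < unit.
Proof. apply Rinv_0_lt_compat, sqrt_lt_R0; lra. Qed.

Lemma unit_sqr : unit * unit * 21 = 1.
Proof.
  unfold unit. rewrite <- (sqrt_sqrt 21) at 3 by lra.
  field. apply Rgt_not_eq, sqrt_lt_R0; lra.
Qed.

Definition tip (c : code) (h : bool) : vec := vscale unit (corner c h).
Definition mk (c : code) : arc := Arc (tip c false) (tip c true).

(** The arc that blocks [c] at its tip [h], by [tip_hits] and [tip_hits_inv]. *)
Definition nxt (c : code) (h : bool) : code := (next_axis (fst c), (snd (snd c), h)).

Lemma unit_cancel u v : vscale unit u = vscale unit v -> u = v.
Proof.
  pose proof unit_pos. intros E. injection E; intros.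
  apply vec_ext; apply Rmult_eq_reg_l with unit; lra.
Qed.

Lemma unit_comb s t u v : comb s t (vscale unit u) (vscale unit v) = vscale unit (comb s t u v).
Proof. apply vec_ext; simpl; ring. Qed.

Lemma mk_inj c c' : mk c = mk c' -> c = c'.
Proof.
  intros E. apply (f_equal aq) in E. apply unit_cancel in E.
  destruct c as [[] [[] []]], c' as [[] [[] []]]; try reflexivity;
    exfalso; injection E; simpl; intros; lra.
Qed.

Lemma tip_sphere c h : on_sphere (tip c h).
Proof.
  pose proof unit_sqr as H. unfold on_sphere, tip.
  replace (dot (vscale unit (corner c h)) (vscale unit (corner c h)))
    with (unit * unit * dot (corner c h) (corner c h)) by (unfold dot; simpl; ring).
  rewrite <- H. f_equal. destruct c as [[] [[] []]], h; unfold dot; simpl; ring.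
Qed.

Lemma mk_valid c : valid_arc (mk c).
Proof.
  split; [apply tip_sphere|split; [apply tip_sphere|split]]; simpl.
  - intros E. apply unit_cancel in E. destruct c as [[] [[] []]]; injection E; intros; lra.
  - intros E. assert (E' : corner c true = vopp (corner c false)).
    { apply unit_cancel. unfold tip in E. rewrite E. apply vec_ext; simpl; ring. }
    destruct c as [[] [[] []]]; injection E'; simpl; intros; lra.
Qed.

Lemma mk_disjoint c c' x : crel (mk c) x -> crel (mk c') x -> c = c'.
Proof.
  intros (s & t & Hs & Ht & E) (s' & t' & Hs' & Ht' & E').
  rewrite E in E'. simpl in E'. unfold tip in E'. rewrite !unit_comb in E'.
  apply unit_cancel in E'. clear E.
  destruct c as [[] [[] []]], c' as [[] [[] []]]; try reflexivity;
    exfalso; injection E'; simpl; intros; lra.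
Qed.

Lemma tip_hits c h : crel (mk (nxt c h)) (tip c h).
Proof.
  destruct c as [i [s t]].
  (* The weights add up to 2, which doubles the two fixed coordinates of the blocking arc; their
     difference times 4 gives the coordinate [sg s]. *)
  exists (1 - sg s / 8), (1 + sg s / 8).
  split; [destruct s; simpl; lra|]. split; [destruct s; simpl; lra|].
  unfold tip; simpl. unfold tip. rewrite unit_comb. f_equal.
  destruct i; apply vec_ext; destruct s, t, h; simpl; lra.
Qed.

Lemma tip_hits_inv c h c' : crel (mk c') (tip c h) -> c' = nxt c h.
Proof. intros H. apply (mk_disjoint _ _ _ H), tip_hits. Qed.

Lemma hit_inv b a e f : hit_at (mk b) (mk a) e f ->
  exists h, e = tip b h /\ f = tip b (negb h) /\ a = nxt b h.
Proof.
  intros ([(-> & ->)|(-> & ->)] & (_ & H)).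
  - exists false. repeat split. apply tip_hits_inv, H.
  - exists true. repeat split. apply tip_hits_inv, H.
Qed.

Lemma tip_hit_at c h : hit_at (mk c) (mk (nxt c h)) (tip c h) (tip c (negb h)).
Proof.
  split; [destruct h; simpl; auto|]. split; [apply tip_sphere|apply tip_hits].
Qed.

Definition sgt (c : code) : R := sg (snd (snd c)).

(** The sign depends only on the two bits of [nxt c h], so all arcs hitting the same arc come from
    the same side. *)
Lemma side_value c h :
  dot (cross (ap (mk (nxt c h))) (aq (mk (nxt c h)))) (tip c (negb h)) =
  unit * unit * unit * (64 * (sgt c * sg h)).
Proof.
  destruct c as [[] [[] []]], h; unfold dot, cross, sgt; simpl; ring.
Qed.

(** Once the sense of rotation is fixed, each turn thus determines [h'] from [h] and the code. *)
Lemma turn_value c h h' : exists r, 0 < r /\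
  det (tip c (negb h)) (tip c h) (tip (nxt c h) h') = r * (sgt c * sg h * sg h').
Proof.
  pose proof unit_pos as Hu.
  exists (unit * unit * unit * (64 - 8 * (sg (fst (snd c)) * sg h'))). split.
  - repeat apply Rmult_lt_0_compat; auto. destruct c as [? [[] ?]], h'; simpl; lra.
  - destruct c as [[] [[] []]], h, h'; unfold det, dot, cross, sgt; simpl; ring.
Qed.

Lemma turn_inv sigma b a c : sigma = 1 \/ sigma = -1 -> turn_sign sigma (mk b) (mk a) (mk c) ->
  exists h h', a = nxt b h /\ c = nxt a h' /\ sg h' = sigma * sg h * sgt b.
Proof.
  intros Hs (e & f & e2 & f2 & H1 & H2 & Hpos).
  destruct (hit_inv _ _ _ _ H1) as (h & -> & -> & ->).
  destruct (hit_inv _ _ _ _ H2) as (h' & -> & -> & ->).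
  exists h, h'. repeat split. destruct (turn_value b h h') as (r & Hr & E). rewrite E in Hpos.
  unfold sgt in *. destruct Hs; subst sigma; destruct h, h', (snd (snd b)); simpl in *; lra.
Qed.

Lemma turn_mk sigma b h h' : sigma = 1 \/ sigma = -1 -> sg h' = sigma * sg h * sgt b ->
  turn_sign sigma (mk b) (mk (nxt b h)) (mk (nxt (nxt b h) h')).
Proof.
  intros Hs E. exists (tip b h), (tip b (negb h)), (tip (nxt b h) h'), (tip (nxt b h) (negb h')).
  split; [apply tip_hit_at|]. split; [apply tip_hit_at|].
  destruct (turn_value b h h') as (r & Hr & ->). rewrite E. unfold sgt.
  destruct Hs; subst sigma; destruct h, (snd (snd b)); simpl; lra.
Qed.

Definition bools : list bool := true :: false :: nil.
Definition codes : list code := list_prod (AX :: AY :: AZ :: nil) (list_prod bools bools).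
Definition example : list arc := map mk codes.

Lemma codes_all c : In c codes.
Proof. destruct c as [[] [[] []]]; simpl; tauto. Qed.

Lemma example_all c : In (mk c) example.
Proof. apply in_map, codes_all. Qed.

Lemma example_inv a : In a example -> exists c, a = mk c.
Proof. intros H. apply in_map_iff in H. destruct H as (c & <- & _). eauto. Qed.

Lemma NoDup_map_mk l : NoDup l -> NoDup (map mk l).
Proof. apply NoDup_map_NoDup_ForallPairs. intros c c' _ _. apply mk_inj. Qed.

Lemma example_SOD : SOD example.
Proof.
  split; [split; [|split; [|split; [|split]]]|].
  - discriminate.
  - apply NoDup_map_mk. repeat constructor; simpl; intuition congruence.
  - intros a Ha. destruct (example_inv a Ha) as (c & ->). apply mk_valid.
  - intros a b Ha Hb Hne x ((_ & Hx) & (_ & Hx')). apply Hne.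
    destruct (example_inv a Ha) as (c & ->). destruct (example_inv b Hb) as (c' & ->).
    f_equal. apply (mk_disjoint c c' x); auto.
  - intros b Hb e He. destruct (example_inv b Hb) as (c & ->).
    destruct He as [->| ->].
    + exists (mk (nxt c false)). split; [apply example_all|].
      split; [apply tip_sphere|apply (tip_hits c false)].
    + exists (mk (nxt c true)). split; [apply example_all|].
      split; [apply tip_sphere|apply (tip_hits c true)].
  - intros a b c e f e' f' Ha Hb Hc H1 H2.
    destruct (example_inv a Ha) as (a' & ->). destruct (example_inv b Hb) as (b' & ->).
    destruct (example_inv c Hc) as (c' & ->).
    destruct (hit_inv _ _ _ _ H1) as (h & -> & -> & E).
    destruct (hit_inv _ _ _ _ H2) as (h' & -> & -> & E').
    assert (S1 := side_value b' h). assert (S2 := side_value c' h').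
    rewrite <- E in S1. rewrite <- E' in S2. rewrite S1, S2.
    rewrite E in E'. injection E' as _ E1 ->. unfold sgt. rewrite E1.
    pose proof unit_pos as Hu.
    assert (0 < unit * unit * unit) by (repeat apply Rmult_lt_0_compat; auto).
    set (p := unit * unit * unit) in *. set (v := sg (snd (snd c')) * sg h').
    assert (v <> 0) by (unfold v; destruct (snd (snd c')), h'; simpl; lra).
    apply Rsqr_pos_lt. apply Rmult_integral_contrapositive_currified; lra.
Qed.

Definition axis_pole (i : axis) : vec :=
  match i with AX => Vec 1 0 0 | AY => Vec 0 1 0 | AZ => Vec 0 0 1 end.

Lemma axis_pole_not_in c r x : r <> 0 -> x = vscale r (axis_pole (fst c)) -> ~ in_arc x (mk c).
Proof.
  pose proof unit_pos as Hu. intros Hr -> (_ & s & t & Hs & Ht & E).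
  assert (E' : vscale (r / unit) (axis_pole (fst c)) = comb s t (corner c false) (corner c true)).
  { apply unit_cancel. rewrite <- unit_comb. unfold comb. fold (tip c false) (tip c true).
    simpl in E. rewrite <- E. apply vec_ext; simpl; field; lra. }
  assert (r / unit <> 0).
  { intros Z. apply Hr. apply Rmult_eq_reg_r with (/ unit);
      [|apply Rinv_neq_0_compat; lra]. unfold Rdiv in Z. lra. }
  set (q := r / unit) in *.
  destruct c as [[] [[] []]]; injection E'; simpl; intros; lra.
Qed.

Lemma example_oriented : oriented 3 example.
Proof.
  exists (axis_pole AX :: axis_pole AY :: axis_pole AZ :: nil).
  split; [reflexivity|]. split; [|split; [|split]].
  - repeat constructor; simpl; intros H; repeat destruct H as [H|H]; auto; injection H; lra.
  - intros c [<-|[<-|[<-|[]]]]; unfold on_sphere, dot; simpl; ring.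
  - intros c c' [<-|[<-|[<-|[]]]] [<-|[<-|[<-|[]]]] H; injection H; lra.
  (* The pole function has to be total: on the example it reads off the axis, which [mk_inj] makes
     well defined, and elsewhere it is the zero vector. *)
  - assert (Hex : forall a, exists v, forall c, a = mk c -> v = axis_pole (fst c)).
    { intros a. destruct (classic (exists c, a = mk c)) as [(c & ->)|Hn].
      - exists (axis_pole (fst c)). intros c' E. rewrite (mk_inj _ _ E). reflexivity.
      - exists (Vec 0 0 0). intros c ->. exfalso; eauto. }
    exists (fun a => proj1_sig (constructive_indefinite_description _ (Hex a))).
    intros a Ha. destruct (constructive_indefinite_description _ (Hex a)) as (v & Hv). simpl.
    destruct (example_inv a Ha) as (c & ->). rewrite (Hv c eq_refl). repeat split.
    + destruct c as [[] [? ?]]; simpl; auto.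
    + destruct c as [[] [? ?]]; unfold det, dot, cross; simpl; ring.
    + apply (axis_pole_not_in c 1); [lra|]. apply vec_ext; simpl; ring.
    + apply (axis_pole_not_in c (-1)); [lra|]. apply vec_ext; simpl; ring.
Qed.

(** These arcs form the swirl of the octant in which the signs of X, Y, Z are [z], [x], [y]. *)
Definition tri (o : bool * (bool * bool)) : list arc :=
  let '(x, (y, z)) := o in mk (AX, (x, y)) :: mk (AY, (y, z)) :: mk (AZ, (z, x)) :: nil.

Definition octants : list (bool * (bool * bool)) := list_prod bools (list_prod bools bools).

Lemma octants_all o : In o octants.
Proof. destruct o as [[] [[] []]]; simpl; tauto. Qed.

Lemma tri_swirl o : swirl example (tri o).
Proof.
  destruct o as [x [y z]]. split; [discriminate|]. split; [|split].
  - apply (NoDup_map_mk ((AX, (x, y)) :: (AY, (y, z)) :: (AZ, (z, x)) :: nil)).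
    repeat constructor; simpl; intuition congruence.
  - intros a [<-|[<-|[<-|[]]]]; apply example_all.
  - assert (Hs : sg x * sg y * sg z = 1 \/ sg x * sg y * sg z = -1)
      by (destruct x, y, z; simpl; lra).
    exists (sg x * sg y * sg z). split; auto. intros [|[|[|i]]] Hi; simpl in Hi; try lia; simpl.
    + apply (turn_mk _ (AX, (x, y)) z x Hs). unfold sgt; destruct x, y, z; simpl; ring.
    + apply (turn_mk _ (AY, (y, z)) x y Hs). unfold sgt; destruct x, y, z; simpl; ring.
    + apply (turn_mk _ (AZ, (z, x)) y z Hs). unfold sgt; destruct x, y, z; simpl; ring.
Qed.

Lemma tri_inj o o' : (forall a, In a (tri o) -> In a (tri o')) -> o = o'.
Proof.
  destruct o as [x [y z]], o' as [x' [y' z']]. intros H.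
  assert (H1 := H (mk (AX, (x, y))) (or_introl eq_refl)).
  assert (H2 := H (mk (AY, (y, z))) (or_intror (or_introl eq_refl))).
  destruct H1 as [E|[E|[E|[]]]]; apply mk_inj in E; try discriminate. injection E as -> ->.
  destruct H2 as [E|[E|[E|[]]]]; apply mk_inj in E; try discriminate. injection E as ->.
  reflexivity.
Qed.

Lemma codes_of l : (forall a, In a l -> In a example) -> exists cs, l = map mk cs.
Proof.
  induction l as [|a l IH]; intros H; [exists nil; auto|].
  destruct IH as (cs & ->); [auto with datatypes|].
  destruct (example_inv a) as (c & ->); [auto with datatypes|]. exists (c :: cs); auto.
Qed.

Lemma sg_inj b b' : sg b = sg b' -> b = b'.
Proof. destruct b, b'; simpl; auto; lra. Qed.

(** Each hit advances the axis and shifts the bits of the code, and two successive turns of the same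
    sense reproduce an earlier bit. Codes therefore have period three, and a swirl of length one is
    excluded because the axis changes. *)
Lemma example_swirl_inv s : swirl example s -> exists o, swirl_equiv (tri o) s.
Proof.
  intros (Hne & Hnd & Hin & sigma & Hs & Hturn).
  destruct (codes_of s Hin) as (cs & Ecs).
  set (n := length s) in *.
  assert (Hn : n <> 0%nat) by (unfold n; destruct s; simpl; [tauto|lia]).
  assert (Hlen : length cs = n) by (unfold n; rewrite Ecs, length_map; auto).
  set (c := fun m => nth (m mod n) cs (AX, (true, true))).
  assert (Hc : forall m, nth (m mod n) s dummy_arc = mk (c m)).
  { intros m. assert (Hm := Nat.mod_upper_bound m n Hn). unfold c.
    rewrite <- (map_nth mk), <- Ecs. apply nth_indep; auto. }
  assert (Ht : forall m, turn_sign sigma (mk (c m)) (mk (c (m + 1)%nat)) (mk (c (m + 2)%nat))).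
  { intros m. specialize (Hturn (m mod n) (Nat.mod_upper_bound m n Hn)).
    rewrite !Nat.Div0.add_mod_idemp_l, !Hc in Hturn. exact Hturn. }
  assert (Hstep : forall m, exists h h', c (m + 1)%nat = nxt (c m) h /\
    c (m + 2)%nat = nxt (c (m + 1)%nat) h' /\ sg h' = sigma * sg h * sgt (c m)).
  { intros m. apply turn_inv; auto. }
  assert (Hfour : forall m, exists i x y z u, c m = (i, (u, x)) /\
    c (m + 1)%nat = (next_axis i, (x, y)) /\
    c (m + 2)%nat = (next_axis (next_axis i), (y, z)) /\
    c (m + 3)%nat = (i, (z, x))).
  { intros m. destruct (Hstep m) as (h & h' & E1 & E2 & E3).
    destruct (Hstep (m + 1)%nat) as (k & k' & F1 & F2 & F3).
    replace (m + 1 + 1)%nat with (m + 2)%nat in * by lia.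
    replace (m + 1 + 2)%nat with (m + 3)%nat in * by lia.
    destruct (c m) as [i [u x]]. rewrite E1 in *. rewrite E2 in *. rewrite F2.
    unfold nxt, sgt in *; simpl in *. injection F1 as <-.
    exists i, x, h, h', u. repeat split.
    assert (k' = x).
    { apply sg_inj. rewrite F3, E3. destruct Hs; subst sigma; destruct h, x; simpl; ring. }
    subst k'. destruct i; reflexivity. }
  (* The bit [u] is not determined by the later arcs of its window; the window starting one step
     earlier, at [n - 1] because indices are natural numbers, identifies it. *)
  assert (Hper : c 3%nat = c 0%nat).
  { assert (Hz : c n = c 0%nat) by (unfold c; rewrite Nat.Div0.mod_same, Nat.Div0.mod_0_l; auto).
    assert (H3 : c (n + 3)%nat = c 3%nat).
    { unfold c. replace (n + 3)%nat with (3 + 1 * n)%nat by lia. rewrite Nat.Div0.mod_add. auto. }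
    destruct (Hfour (n - 1)%nat) as (i & x & y & z & u & E1 & E2 & E3 & E4).
    destruct (Hfour n) as (i' & x' & y' & z' & u' & F1 & F2 & F3 & F4).
    replace (n - 1 + 1)%nat with n in E2 by lia.
    replace (n - 1 + 2)%nat with (n + 1)%nat in E3 by lia.
    replace (n - 1 + 3)%nat with (n + 2)%nat in E4 by lia.
    rewrite <- H3, <- Hz. congruence. }
  assert (Hn13 : (n = 1 \/ n = 3)%nat).
  { assert (H0 : (3 mod n = 0 mod n)%nat).
    { apply (NoDup_nth s dummy_arc); auto; try (apply Nat.mod_upper_bound; auto).
      rewrite !Hc, Hper. auto. }
    rewrite Nat.Div0.mod_0_l in H0. apply Nat.Div0.mod_divides in H0. destruct H0 as (q & Hq).
    destruct n as [|[|[|[|n']]]]; try lia. destruct q; lia. }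
  destruct (Hfour 0%nat) as (i & x & y & z & u & E0 & E1 & E2 & E3).
  simpl in E1, E2, E3. rewrite Hper, E0 in E3. injection E3 as ->.
  destruct Hn13 as [H1|H3].
  - exfalso. assert (c 1%nat = c 0%nat) by (unfold c; rewrite H1; reflexivity).
    rewrite E0, E1 in H. injection H. destruct i; discriminate.
  - assert (Es : s = mk (c 0%nat) :: mk (c 1%nat) :: mk (c 2%nat) :: nil).
    { rewrite <- !Hc, H3. simpl. unfold n in H3.
      destruct s as [|a [|b [|d [|]]]]; try discriminate; reflexivity. }
    rewrite Es, E0, E1, E2. destruct i.
    + exists (z, (x, y)), 0%nat. reflexivity.
    + exists (y, (z, x)), 1%nat. reflexivity.
    + exists (x, (y, z)), 2%nat. reflexivity.
Qed.

Lemma example_exactly_eight : exactly_swirls 8 example.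
Proof.
  exists (map tri octants). split; [reflexivity|]. split; [split; [|split]|].
  - apply NoDup_map_NoDup_ForallPairs.
    + intros o o' _ _ E. apply tri_inj. rewrite E. auto.
    + repeat constructor; simpl; intuition congruence.
  - intros s H. apply in_map_iff in H. destruct H as (o & <- & _). apply tri_swirl.
  - intros s s' H H' (k & E). apply in_map_iff in H, H'.
    destruct H as (o & <- & _). destruct H' as (o' & <- & _). f_equal.
    apply tri_inj. intros a Ha. rewrite E. apply rotl_In, Ha.
  - intros s Hs. destruct (example_swirl_inv s Hs) as (o & Ho).
    exists (tri o). split; auto. apply in_map, octants_all.
Qed.

Theorem mainTheorem2 :
  (forall D : list arc, SD D -> oriented 3 D ->
     at_least_swirls 8 D /\ (12 <= length D)%nat) /\
  (exists D : list arc, SOD D /\ oriented 3 D /\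
     exactly_swirls 8 D /\ length D = 12%nat).
Proof.
  split.
  - apply three_oriented_bounds.
  - exists example.
    split; [apply example_SOD|split; [apply example_oriented|
      split; [apply example_exactly_eight|reflexivity]]].
Qed.
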